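(* Consider the repeated newsvendor with horizon $T$, action space $\mathcal{X}=[0,B]$ and demand space $[0,B]$. At each round $t$ the learner chooses $X_t\in[0,B]$, a latent demand $D_t\in[0,B]$ is realized, and the learner observes only $O_t=\psi(X_t,D_t):=(\min\{D_t,X_t\},\mathbf{1}\{D_t\le X_t\})$. The history is $H_t=((X_s,O_s))_{s=1}^t$, $H_0=\emptyset$. The loss is $\ell(x,d)=h(x-d)_++b(d-x)_+$ with $h,b>0$, and $\gamma=b/(b+h)$. The environment $\mathbb{P}^\star$ is a distribution over complete demand trajectories $D_{1:T}$; let $f^\star(x):=\mathbb{E}_{\mathbb{P}^\star}[\ell(x,D_t)]$ (assumed not to depend on $t$), $x^\star\in\arg\min_{x\in[0,B]}f^\star(x)$, $r_t:=f^\star(X_t)-f^\star(x^\star)$, and for a policy $\pi$ let $\mathrm{BReg}_T(\pi;\mathbb{P}^\star):=\mathbb{E}_{\mathbb{P}^\star_\pi}[\sum_{t=1}^T r_t]$, where $\mathbb{P}^\star_\pi$ is the law of the interaction generated by $\pi$ in $\mathbb{P}^\star$. For $t\in[T]$ and a history value $h$, let $Q_t^\star(\cdot\mid h)$ be the conditional law under $\mathbb{P}^\star$ of $D_{1:T}$ given $H_{t-1}=h$, and let $Q_{t,\theta}(\cdot\mid h)$ be a learned probability kernel on $[0,B]^T$. For a completed trajectory $d_{1:T}$ let $\hat x(d_{1:T})=\inf\{x:\frac1T\sum_{s=1}^T\mathbf{1}\{d_s\le x\}\ge\gamma\}$ (the left empirical $\gamma$-quantile, an empirical risk minimizer of $x\mapsto\frac1T\sum_s\ell(x,d_s)$).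 The ideal policy $\pi_\star$ at each round $t$ samples $\widetilde D^{(t)}_{1:T}\sim Q_t^\star(\cdot\mid H_{t-1})$ and plays $X_t=\hat x(\widetilde D^{(t)}_{1:T})$; the deployed policy $\pi_\theta$ does the same with $Q_{t,\theta}(\cdot\mid H_{t-1})$ in place of $Q_t^\star$. Define the on-policy completion mismatch $$\Delta_T^{\mathrm{comp}}(\theta;\pi_\theta):=\sum_{t=1}^T\mathbb{E}_{H_{t-1}\sim\mathbb{P}^\star_{\pi_\theta}}\Big[\mathrm{KL}\big(Q_t^\star(\cdot\mid H_{t-1})\,\|\,Q_{t,\theta}(\cdot\mid H_{t-1})\big)\Big].$$ Assume: (i) there is $V_{\mathrm{comp}}\in[1,\infty)$ such that for all $t\in[T]$ and all histories $h$, $Q_{t,\theta}(\cdot\mid h)\ll Q_t^\star(\cdot\mid h)$ and $\sup_F Q_{t,\theta}(F\mid h)/Q_t^\star(F\mid h)\le V_{\mathrm{comp}}$, the supremum over measurable sets $F\subseteq[0,B]^T$; (ii) under the interaction law of $\pi_\star$ in $\mathbb{P}^\star$, $\mathbb{E}[r_t\mid H_{t-1}]=\mathbb{E}[r_t]$ almost surely for every $t$; (iii) $B'>0$ is such that $\sup r_t-\inf r_t\le B'$ almost surely. Then $$\mathrm{BReg}_T(\pi_\theta;\mathbb{P}^\star)\le\mathrm{BReg}_T(\pi_\star;\mathbb{P}^\star)+B'\sqrt{\frac{T(2+\log V_{\mathrm{comp}})}{2}\,\Delta_T^{\mathrm{comp}}(\theta;\pi_\theta)}.$$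
   Context: $(a)_+=\max\{a,0\}$. KL denotes Kullback–Leibler divergence. The conditional-mean assumption (ii) is stated in the paper as $\mathbb{E}_{\mathbb{P}^\star}[r_t\mid H_{t-1}]=\mathbb{E}_{\mathbb{P}^\star}[r_t]$ a.s.; its proof uses it under the interaction law of the ideal policy. *)

(* Defs.v *)
From HB Require Import structures.
From mathcomp Require Import all_boot all_order all_algebra.
From mathcomp Require Import all_classical all_reals all_analysis.

Set Implicit Arguments.
Unset Strict Implicit.
Unset Printing Implicit Defensive.

Import Order.TTheory GRing.Theory Num.Theory.
Import numFieldNormedType.Exports.
Local Open Scope classical_set_scope.
Local Open Scope ring_scope.

Section newsvendor_defs.
Variable R : realType.

(** Complete demand trajectories D_{1:T} (rounds are 0-indexed by 'I_T). *)
Definition traj (T : nat) := (T.-tuple R)%type.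

(** One history entry (X_s, O_s) with O_s = (min{D_s,X_s}, 1{D_s <= X_s}). *)
Definition hstep := (R * (R * bool))%type.

(** Histories are represented as T-tuples of entries, padded with [hdef]:
    the history H before (0-indexed) round t has entries s < t equal to
    (X_s, O_s) and entries s >= t equal to [hdef]. *)
Definition hist (T : nat) := (T.-tuple hstep)%type.
Definition hdef : hstep := (0, (0, false)).

Definition is_hist (T : nat) (B : R) (t : 'I_T) (hi : hist T) : Prop :=
  forall s : 'I_T,
    (if (s < t)%N
     then (0 <= (tnth hi s).1 <= B) /\ (0 <= (tnth hi s).2.1 <= B)
     else tnth hi s = hdef).

Definition box (T : nat) (B : R) : set (traj T) :=
  [set d | forall s : 'I_T, 0 <= tnth d s <= B].

Definition nv_loss (h b x d : R) : R :=
  h * Num.max (x - d) 0 + b * Num.max (d - x) 0.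

Definition psi (x d : R) : R * bool := (Num.min d x, d <= x).

Definition xhat (T : nat) (gam : R) (d : traj T) : R :=
  inf [set x : R | gam <= (\sum_(s < T) (nat_of_bool (tnth d s <= x)%R)%:R) / T%:R].

(** Kullback--Leibler divergence KL(P || Q) = \int dP/dQ log(dP/dQ) dQ when
    P << Q (a density f = dP/dQ exists), and +oo otherwise
    (the infimum over the empty set of densities is +oo; when a density
    exists the value does not depend on the chosen version). *)
Definition is_density {d} {X : measurableType d}
    (P Q : set X -> \bar R) (f : X -> R) : Prop :=
  [/\ measurable_fun setT f, (forall x, 0 <= f x) &
      forall A, measurable A -> P A = (\int[Q]_(x in A) (f x)%:E)%E].

Definition KL {d} {X : measurableType d} (P Q : set X -> \bar R) : \bar R :=
  ereal_inf [set v | exists f, is_density P Q f /\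
                     v = (\int[Q]_x (f x * ln (f x))%:E)%E].

(** Conditional expectation (version): Z is a version of E[Y | sigma(H)]
    under P, i.e. Z is sigma(H)-measurable and has the same integrals as Y
    over every event of sigma(H) = { H^{-1}(A) | A measurable }. *)
Definition cexp_version {dO} {Om : measurableType dO} (P : probability Om R)
    {dH} {TH : measurableType dH} (Y : Om -> R) (H : Om -> TH) (Z : Om -> R)
    : Prop :=
  (exists g : TH -> R, measurable_fun setT g /\ Z = g \o H) /\
  forall A, measurable A ->
    (\int[P]_(w in H @^-1` A) (Z w)%:E = \int[P]_(w in H @^-1` A) (Y w)%:E)%E.

Section interaction.
Variables (T : nat) (gam : R).
Variables (dO : measure_display) (Om : measurableType dO).
(* D : the latent demand trajectory; Dt t : the completion sampled at round t *)
Variables (D : Om -> traj T) (Dt : 'I_T -> Om -> traj T).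

Definition trajdef : traj T := [tuple (0 : R) | _ < T].

Definition act (t : 'I_T) (w : Om) : R := xhat gam (Dt t w).
Definition obs (t : 'I_T) (w : Om) : R * bool := psi (act t w) (tnth (D w) t).
Definition histo (t : 'I_T) (w : Om) : hist T :=
  [tuple (if (s < t)%N then (act s w, obs s w) else hdef) | s < T].
Definition past (t : 'I_T) (w : Om) : (traj T * (T.-tuple (traj T)))%type :=
  (D w, [tuple (if (s < t)%N then Dt s w else trajdef) | s < T]).

(** (Om, P, D, Dt) realizes the interaction law of the policy that at each
    round t samples Dt^(t) ~ Q t (. | H_{t-1}) and plays xhat(Dt^(t)), in the
    environment Pstar: D ~ Pstar, and conditionally on everything generated
    before (D, Dt^(s) for s < t), Dt^(t) has law Q t (. | H_{t-1}). *)
Definition interaction (P : probability Om R) (Pstar : probability (traj T) R)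
    (Q : 'I_T -> R.-pker (hist T) ~> (traj T)) : Prop :=
  [/\ measurable_fun setT D,
      (forall t, measurable_fun setT (Dt t)),
      (forall F, measurable F -> P (D @^-1` F) = Pstar F) &
      (forall t A F, measurable A -> measurable F ->
         P (past t @^-1` A `&` Dt t @^-1` F) =
         (\int[P]_(w in past t @^-1` A) Q t (histo t w) F)%E)].

Definition is_cond_law (P : probability Om R)
    (Q : 'I_T -> R.-pker (hist T) ~> (traj T)) : Prop :=
  forall t A F, measurable A -> measurable F ->
    P (histo t @^-1` A `&` D @^-1` F) =
    (\int[P]_(w in histo t @^-1` A) Q t (histo t w) F)%E.

Definition regr (fs : R -> R) (xs : R) (t : 'I_T) (w : Om) : R :=
  fs (act t w) - fs xs.

Definition BReg (P : probability Om R) (fs : R -> R) (xs : R) : \bar R :=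
  (\int[P]_w (\sum_(t < T) regr fs xs t w)%:E)%E.

Definition Delta_comp (P : probability Om R)
    (Qs Qth : 'I_T -> R.-pker (hist T) ~> (traj T)) : \bar R :=
  (\sum_(t < T) \int[P]_w KL (Qs t (histo t w)) (Qth t (histo t w)))%E.

End interaction.
End newsvendor_defs.

(* Main.v *)
(** Pinsker's inequality is applied in the direction in which the mismatch is
    measured, so [V] enters only through [Q_theta << Q_star].

    Round by round, the law of the past under the deployed policy is dominated
    by its law under the ideal policy, so the assumption that the conditional
    mean regret [G_t(H)] of the ideal policy is a constant [c_t] transfers to
    the histories generated by the deployed policy.  On such a history the
    regret of the deployed policy exceeds [c_t] by at most
    [B' TV(Q_star, Q_theta)], and the elementary bound
      [|1 - f| <= l (f ln f - f + 1) + (f + 1) / (2 l)],  [l > 0],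
    for the density [f] of [Q_star] with respect to [Q_theta] gives
      [TV <= (l KL + 1 / l) / 2].
    This is linear in [KL], so it can be averaged over histories and summed over
    rounds before choosing [l = sqrt (T / Delta)]; the result is
    [B' sqrt (T Delta)], and [1 <= (2 + ln V) / 2]. *)
Require Import Defs.
From HB Require Import structures.
From mathcomp Require Import all_boot all_order all_algebra.
From mathcomp Require Import all_classical all_reals all_analysis.
From mathcomp Require Import measurable_realfun ring lra.
Import Order.TTheory GRing.Theory Num.Theory.
Import numFieldNormedType.Exports.
Local Open Scope classical_set_scope.
Local Open Scope ring_scope.

Set Implicit Arguments.
Unset Strict Implicit.

(** * Mixtures of measures and disintegration *)

Section mixture.
Local Open Scope ereal_scope.
Context (R : realType).
Import HBNNSimple.

(** Simple functions approximate [f], and monotone convergence moves the limit through both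
    integrals. The right-hand side sees the mixture only through its values on sets. *)
Lemma integral_mixtureE d1 d2 (X : measurableType d1) (W : measurableType d2)
    (mu : {measure set X -> \bar R}) (D : set X)
    (k : X -> {measure set W -> \bar R}) (f : W -> \bar R)
    (mf : measurable_fun setT f) :
  measurable D ->
  (forall U, measurable U -> measurable_fun setT (fun x => k x U)) ->
  (forall z, 0 <= f z) ->
  \int[mu]_(x in D) \int[k x]_z f z =
  limn (fun n => let g := nnsfun_approx measurableT mf n in
    \sum_(r \in range g) r%:E * \int[mu]_(x in D) k x (g @^-1` [set r])).
Proof.
move=> mD mk f0; set f_ := nnsfun_approx measurableT mf.
have limE x : \int[k x]_z f z = limn (fun n => \int[k x]_z (f_ n z)%:E).
  rewrite -monotone_convergence//; last 3 first.
  - by move=> n; exact/measurable_EFinP.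
  - by move=> n z _; rewrite lee_fin.
  - by move=> z _ a b ab; rewrite lee_fin; exact/lefP/nd_nnsfun_approx.
  by apply: eq_integral => z _; apply/esym/cvg_lim => //; exact: cvg_nnsfun_approx.
under eq_integral do rewrite limE.
rewrite monotone_convergence//; last 3 first.
- move=> n; apply: measurable_funTS; apply: measurable_fun_integral_kernel => //.
    by move=> z; rewrite lee_fin.
  exact/measurable_EFinP.
- by move=> n x _; apply: integral_ge0 => z _; rewrite lee_fin.
- move=> x _ a b ab; apply: ge0_le_integral => //.
  + by move=> z _; rewrite lee_fin.
  + exact/measurable_EFinP.
  + exact/measurable_EFinP.
  + by move=> z _; rewrite lee_fin; exact/lefP/nd_nnsfun_approx.
congr (limn _); apply/funext => n /=.
under eq_integral do rewrite integralT_nnsfun sintegralE.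
have mkr r : measurable_fun D (fun x => k x (f_ n @^-1` [set r])).
  by apply: measurable_funTS; exact: mk.
rewrite ge0_integral_fsum//; last 2 first.
- by move=> r; exact: measurable_funeM.
- by move=> r x _; exact: nnsfun_mulemu_ge0.
apply: eq_fsbigr => r; rewrite inE => -[z _ <-].
by rewrite ge0_integralZl// lee_fin.
Qed.

(* Both mixtures are limits of the same expression in their values on sets. *)
Lemma eq_integral_mixture d1 d2 d3 (X1 : measurableType d1)
    (X2 : measurableType d2) (W : measurableType d3)
    (mu1 : {measure set X1 -> \bar R}) (D1 : set X1)
    (k1 : X1 -> {measure set W -> \bar R})
    (mu2 : {measure set X2 -> \bar R}) (D2 : set X2)
    (k2 : X2 -> {measure set W -> \bar R}) (f : W -> \bar R) :
  measurable D1 -> measurable D2 ->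
  (forall U, measurable U -> measurable_fun setT (fun x => k1 x U)) ->
  (forall U, measurable U -> measurable_fun setT (fun x => k2 x U)) ->
  (forall U, measurable U ->
    \int[mu1]_(x in D1) k1 x U = \int[mu2]_(x in D2) k2 x U) ->
  (forall z, 0 <= f z) -> measurable_fun setT f ->
  \int[mu1]_(x in D1) \int[k1 x]_z f z = \int[mu2]_(x in D2) \int[k2 x]_z f z.
Proof.
move=> mD1 mD2 mk1 mk2 kE f0 mf.
rewrite !(@integral_mixtureE _ _ _ _ _ _ _ _ mf)//.
congr (limn _); apply/funext => n /=.
by apply: eq_fsbigr => r _; rewrite kE.
Qed.

Section pullback.
Context d1 d2 d3 (W : measurableType d1) (X : measurableType d2)
  (Y : measurableType d3) (k : R.-pker X ~> Y) (eta : W -> X).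

(** Used to reindex a kernel on histories by pasts. The argument [meta] is carried along because
    measurability of [eta] is what makes the result a kernel. *)
Definition kpull (meta : measurable_fun setT eta) (w : W) :
  {measure set Y -> \bar R} := k (eta w).

Hypothesis meta : measurable_fun setT eta.

Let measurable_kpull U : measurable U ->
  measurable_fun setT (kpull meta ^~ U).
Proof. by move=> mU; exact: (measurableT_comp (measurable_kernel k U mU)). Qed.

HB.instance Definition _ := isKernel.Build _ _ _ _ _ (kpull meta)
  measurable_kpull.

Let kpull_prob w : kpull meta w setT = 1.
Proof. exact: prob_kernel. Qed.

HB.instance Definition _ := Kernel_isProbability.Build _ _ _ _ _
  (kpull meta) kpull_prob.
End pullback.

Section disintegration.
Context d d1 d2 (Om : measurableType d) (Y : measurableType d1)
  (Z : measurableType d2) (P : probability Om R) (U : Om -> Y) (V : Om -> Z)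
  (k : R.-pker Y ~> Z).
Hypotheses (mU : measurable_fun setT U) (mV : measurable_fun setT V).
Hypothesis UV : forall A F, measurable A -> measurable F ->
  P (U @^-1` A `&` V @^-1` F) = \int[P]_(w in U @^-1` A) k (U w) F.

(** [UV] is the case of rectangles, a pi-system generating the product sigma-algebra; the sets that
    satisfy the identity form a Dynkin system. *)
Lemma disintegration_set (N : set (Y * Z)) : measurable N ->
  P [set w | N (U w, V w)] = \int[P]_w k (U w) (xsection N (U w)).
Proof.
move=> mN; have k1 y : k y [set: Z] = 1 by exact: prob_kernel.
have mUV : measurable_fun setT (fun w => (U w, V w)) by exact: measurable_fun_pair.
have mX (S : set (Y * Z)) : measurable S ->
    measurable_fun setT (fun w => k (U w) (xsection S (U w))).
  move=> mS; apply: (@measurableT_comp _ _ _ _ _ _ (fun y => k y (xsection S y))) => //.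
  by apply: measurable_fun_xsection_finite_kernel; rewrite inE.
have mP (S : set (Y * Z)) : measurable S -> measurable [set w | S (U w, V w)].
  by move=> mS; rewrite -[X in measurable X]setTI; exact: mUV.
pose G := [set A `*` B | A in @measurable _ Y & B in @measurable _ Z].
have mG : @measurable _ (Y * Z)%type = <<s G >> by exact: measurable_prod_measurableType.
pose H : set_system (Y * Z) := [set S |
  P [set w | S (U w, V w)] = \int[P]_w k (U w) (xsection S (U w))].
suff : H N by [].
rewrite mG in mN; apply: (dynkin_induction mG) mN; rewrite /H/= {H}.
- move=> _ _ [A mA [B mB <-]] [A' mA' [B' mB' <-]].
  exists (A `&` A'); first exact: measurableI.
  exists (B `&` B'); first exact: measurableI.
  by rewrite setXI.
- rewrite [X in P X](_ : _ = setT)//.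
  under eq_integral do rewrite -setXTT in_xsectionX ?inE// prob_kernel.
  by rewrite integral_cst// mul1e.
- move=> _ [A mA [B mB <-]] /=; rewrite (_ : [set w | _] = U @^-1` A `&` V @^-1` B)//.
  rewrite UV// [LHS]integral_mkcond; apply: eq_integral => w _; rewrite patchE.
  case: ifPn; rewrite (inE,notin_setE)/= => Uw.
    by rewrite in_xsectionX// inE.
  by rewrite notin_xsectionX ?measure0// notin_setE.
- move=> S mS IH; rewrite (_ : [set w | _] = ~` [set w | S (U w, V w)])//.
  rewrite probability_setC; last exact: mP.
  have kC w : k (U w) (xsection (~` S) (U w)) = 1 - k (U w) (xsection S (U w)).
    rewrite (_ : xsection (~` S) (U w) = setT `\` xsection S (U w)); last first.
      by rewrite setTD; apply/seteqP; split => z; rewrite /xsection/= !inE /= ?inE.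
    rewrite -[in RHS](k1 (U w)) -[in RHS](setTI (xsection _ _)).
    apply: measureD => //; first exact: measurable_xsection.
    by move: (k1 (U w)) => /= ->; rewrite ltry.
  rewrite IH; under [RHS]eq_integral do rewrite kC.
  have kS1 w : k (U w) (xsection S (U w)) <= 1.
    by rewrite -(k1 (U w)) le_measure ?inE//; exact: measurable_xsection.
  rewrite integralB//.
  + by rewrite integral_cst// mul1e [X in _ = X - _]probability_setT.
  + exact: finite_measure_integrable_cst.
  + apply: (@le_integrable _ _ _ _ _ _ _ (cst 1)) => //.
    * exact: mX.
    * by move=> w _ /=; rewrite gee0_abs// normr1.
    * exact: finite_measure_integrable_cst.
- move=> F mF tF IH.
  rewrite (_ : [set w | _] = \bigcup_n [set w | F n (U w, V w)])//.
  rewrite measure_bigcup//; last 2 first.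
    by move=> i _; exact: mP.
    apply/trivIsetP => i j _ _ ij; rewrite -subset0 => w [Fi Fj].
    have : (F i `&` F j) (U w, V w) by [].
    by move/trivIsetP : tF => ->.
  transitivity (\sum_(0 <= n <oo) \int[P]_w k (U w) (xsection (F n) (U w))).
    rewrite (@eq_eseriesl _ _ xpredT); last by move=> n; exact: in_setT.
    by apply: eq_eseriesr => n _; exact: IH.
  rewrite -integral_nneseries//; last by move=> n; exact: mX.
  apply: eq_integral => w _; rewrite xsection_bigcup measure_bigcup//; last 2 first.
  + by move=> i _; exact: measurable_xsection.
  + exact: trivIset_xsection.
  by apply/esym/eq_eseriesl => n; exact: in_setT.
Qed.

(** Evaluation at [V w] is integration against the Dirac mass there, so both sides are mixtures, and
    [UV] says that these agree on sets. *)
Lemma disintegration_fun (A : set Y) (f : Z -> \bar R) :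
  measurable A -> (forall z, 0 <= f z) -> measurable_fun setT f ->
  \int[P]_(w in U @^-1` A) f (V w) = \int[P]_(w in U @^-1` A) \int[k (U w)]_z f z.
Proof.
move=> mA f0 mf.
have mUA : measurable (U @^-1` A) by rewrite -[X in measurable X]setTI; exact: mU.
transitivity (\int[P]_(w in U @^-1` A) \int[\d_(V w)]_z f z).
  by apply: eq_integral => w _; rewrite integral_dirac// diracT mul1e.
have mD F : measurable F -> measurable_fun setT (fun w => \d_(V w) F : \bar R).
  move=> mF; apply/measurable_EFinP.
  by rewrite (_ : (fun x => _) = (\1_F : Z -> R) \o V)//; exact: measurableT_comp.
apply: eq_integral_mixture => //.
- by move=> F mF; exact: (measurableT_comp (measurable_kernel k F mF)).
- move=> F mF; rewrite -UV// setIC.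
  by rewrite -integral_indic// -[X in measurable X]setTI; exact: mV.
Qed.

End disintegration.
End mixture.

(** * Pinsker's inequality *)

(** With [s = sqrt f], [|1 - f| = |1 - s| (1 + s)]. The entropy term dominates the Hellinger term
    [(s - 1)^2], and Young's inequality with weight [l] splits the product. *)
Lemma abs_entropy_bound (R : realType) (f l : R) : 0 <= f -> 0 < l ->
  `|1 - f| <= l * (f * ln f - f + 1) + (f + 1) / (2 * l).
Proof.
move=> f0 l0; set s := Num.sqrt f.
have s0 : 0 <= s by exact: sqrtr_ge0.
have fE : f = s ^+ 2 by rewrite sqr_sqrtr.
(* [s ln s >= s - 1], multiplied by [2 s] *)
have hell : (s - 1) ^+ 2 <= f * ln f - f + 1.
  have [s1|] := ltP 0 s; last first.
    move=> s0'; have sE : s = 0 by apply/eqP; rewrite eq_le s0 s0'.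
    have -> : f = 0 by rewrite fE sE expr0n.
    rewrite sE.
    by rewrite mul0r; lra.
  have lns : s - 1 <= s * ln s.
    have := @le_ln1Dx R (s^-1 - 1); rewrite (_ : 1 + (s^-1 - 1) = s^-1); last by ring.
    rewrite lnV ?posrE// => H.
    have /H{}H : -1 < s^-1 - 1 by rewrite ltrBrDl subrr invr_gt0.
    have : s * (1 - s^-1) <= s * ln s by rewrite ler_pM2l//; lra.
    by rewrite mulrBr mulr1 divff ?gt_eqF.
  rewrite fE lnXn// mulr2n; nra.
have e1 : 1 - f = (1 - s) * (1 + s) by rewrite fE; ring.
rewrite e1 normrM (ger0_norm (_ : 0 <= 1 + s)); last by lra.
apply: (@le_trans _ _ (l * (s - 1) ^+ 2 + (f + 1) / (2 * l))); last first.
  by rewrite lerD2r ler_pM2l.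
have -> : (s - 1) ^+ 2 = `|1 - s| ^+ 2 by rewrite -normrX ger0_norm ?sqr_ge0//; ring.
set a := `|1 - s|.
have -> : l * a ^+ 2 + (f + 1) / (2 * l) = (2 * l ^+ 2 * a ^+ 2 + (f + 1)) / (2 * l).
  by field; rewrite gt_eqF.
rewrite ler_pdivlMr; last by lra.
(* The first square gives [4 l a (1 + s) <= 4 l^2 a^2 + (1 + s)^2], the second
   [(1 + s)^2 <= 2 (s^2 + 1)]. *)
have sq1 : 0 <= (2 * l * a - (1 + s)) ^+ 2 by exact: sqr_ge0.
have sq2 : 0 <= (1 - s) ^+ 2 by exact: sqr_ge0.
rewrite fE; nra.
Qed.

Lemma le_mul_sqrt_of_forall (R : realType) (x c n D : R) : 0 < c -> 0 < n -> 0 <= D ->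
  (forall l, 0 < l -> x <= c / 2 * (l * D + n / l)) -> x <= c * Num.sqrt (n * D).
Proof.
move=> c0 n0; rewrite le_eqVlt => /predU1P[<-|D0] H.
  rewrite mulr0 sqrtr0 mulr0 leNgt; apply/negP => x0.
  (* If [x > 0], this choice of [l] turns the bound into [x <= x / 2]. *)
  have /H : 0 < c * n / x by rewrite divr_gt0// mulr_gt0.
  rewrite mulr0 add0r (_ : c / 2 * _ = x / 2); first by lra.
  by field; rewrite !gt_eqF.
set q := Num.sqrt (n * D).
have q0 : 0 < q by rewrite sqrtr_gt0 mulr_gt0.
have qE : q ^+ 2 = n * D by rewrite sqr_sqrtr// ltW// mulr_gt0.
(* This is the minimizer [l = sqrt (n / D)], for which [l D] and [n / l] both equal [q]. *)
have /H : 0 < q / D by rewrite divr_gt0.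
rewrite (_ : c / 2 * _ = c * q)//.
have -> : n = q ^+ 2 / D by rewrite qE; field; rewrite gt_eqF.
by field; rewrite !gt_eqF.
Qed.

(** * Comparing integrals of possibly non-measurable functions *)

Section lower_integral.
Local Open Scope ereal_scope.
Context d (X : measurableType d) (R : realType).
Variable mu : {measure set X -> \bar R}.

(* For nonnegative functions the integral is a supremum over the simple functions
   below the integrand. This serves to integrate [KL (Q1 h) (Q2 h)], which need
   not be measurable in [h]. *)
Lemma ge0_le_integral_lower (f g : X -> \bar R) : (forall x, 0 <= f x) ->
  (forall x, f x <= g x) -> \int[mu]_x f x <= \int[mu]_x g x.
Proof.
move=> f0 fg; have g0 x : 0 <= g x by exact: le_trans (fg x).
rewrite !ge0_integralTE//; apply: ereal_sup_le => _ [h /= hf <-].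
by exists h => //= x; exact: le_trans (hf x) (fg x).
Qed.

(** Measurability of [f] allows the exceptional null set to be cut out of its integral; the
    pointwise comparison then applies to an arbitrary [g]. *)
Lemma ae_ge0_le_integral_lower (f g : X -> \bar R) : measurable_fun setT f ->
  (forall x, 0 <= f x) -> (forall x, 0 <= g x) ->
  (\forall x \ae mu, f x <= g x) -> \int[mu]_x f x <= \int[mu]_x g x.
Proof.
move=> mf f0 g0 [N [mN N0 /subsetCl fg]].
rewrite (ge0_negligible_integral mN)// setTD integral_mkcond.
apply: ge0_le_integral_lower => x; rewrite patchE; case: ifPn => // /set_mem.
exact: fg.
Qed.

(** Serves to replace the regret, possibly non-measurable because [fs] is arbitrary outside
    [[0, B]], by a measurable version. *)
Lemma ae_ge0_eq_integral_nonmeasurable (f g : X -> \bar R) :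
  measurable_fun setT g -> (forall x, 0 <= f x) -> (forall x, 0 <= g x) ->
  (\forall x \ae mu, f x = g x) -> \int[mu]_x f x = \int[mu]_x g x.
Proof.
move=> mg f0 g0 aefg; apply/eqP; rewrite eq_le; apply/andP; split; last first.
  apply: ae_ge0_le_integral_lower => //.
  by apply: filterS aefg => x ->.
have [N [mN N0 /subsetCl fg]] := aefg.
(* A measurable majorant of [f] on the whole space that equals [g] off the null set. *)
pose g' x := if x \in N then +oo else g x.
have mg' : measurable_fun setT g'.
  apply: measurable_fun_ifT => //; apply: (measurable_fun_bool true).
  rewrite setTI (_ : _ @^-1` _ = N)//.
  by apply/seteqP; split => x /=; [move/set_mem|move/mem_set].
have g'0 x : 0 <= g' x by rewrite /g'; case: ifP.
apply: (@le_trans _ _ (\int[mu]_x g' x)).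
  apply: ge0_le_integral_lower => // x; rewrite /g'; case: ifPn => [_|].
    by rewrite leey.
  by rewrite notin_setE => /fg ->.
rewrite le_eqVlt; apply/orP; left; apply/eqP.
apply: ge0_ae_eq_integral => //; exists N; split => // x /= /not_implyP[_].
by apply: contra_notP => Nx; rewrite /g' memNset.
Qed.

Lemma ae_eq_integral_nonmeasurable (D : set X) (f g : X -> \bar R) :
  measurable D -> measurable_fun setT g ->
  (\forall x \ae mu, f x = g x) ->
  \int[mu]_(x in D) f x = \int[mu]_(x in D) g x.
Proof.
move=> mD mg fg; rewrite integral_mkcond [RHS]integral_mkcond.
have mgD : measurable_fun setT (g \_ D).
  by apply/(measurable_restrictT _ mD); exact: measurable_funTS.
rewrite integralE [RHS]integralE; congr (_ - _);
  apply: ae_ge0_eq_integral_nonmeasurable => //;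
  do ?[exact: measurable_funepos|exact: measurable_funeneg];
  apply: filterS fg => x fgx;
  by rewrite ?funeposE ?funenegE !patchE fgx.
Qed.

(* The positive and negative parts are compared separately. *)
Lemma ae_le_integral (f g : X -> \bar R) :
  measurable_fun setT f -> measurable_fun setT g^\- ->
  (\forall x \ae mu, f x <= g x) -> \int[mu]_x f x <= \int[mu]_x g x.
Proof.
move=> mf mg fg; rewrite integralE [leRHS]integralE; apply: leeB.
  apply: ae_ge0_le_integral_lower => //; first exact: measurable_funepos.
  by apply: filterS fg => x fgx; rewrite !funeposE ge_max !le_max fgx lexx orbT.
apply: ae_ge0_le_integral_lower => //.
by apply: filterS fg => x fgx; rewrite !funenegE ge_max !le_max leeN2 fgx lexx orbT.
Qed.

End lower_integral.

Section density.
Context d (X : measurableType d) (R : realType).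
Variables (P Q : {measure set X -> \bar R}) (f : X -> R).
Hypothesis densf : is_density P Q f.

(** [P] is the mixture over [Q] of the masses [f x] placed at [x]: on sets this is the definition of
    a density, and [eq_integral_mixture] extends it to functions. *)
Lemma integral_density (phi : X -> \bar R) : measurable_fun setT phi ->
  (forall x, 0 <= phi x)%E ->
  (\int[P]_x phi x = \int[Q]_x ((f x)%:E * phi x))%E.
Proof.
move=> mphi phi0; have [mf f0 PE] := densf.
(* A mixture over a one-point law, the form that [eq_integral_mixture] expects. *)
have -> : (\int[P]_x phi x = \int[@dirac _ X point R]_y \int[P]_x phi x)%E.
  by rewrite integral_dirac// diracT mul1e.
rewrite (@eq_integral_mixture _ _ _ _ _ _ _ _ setT (fun=> P) Q setT
  (fun x => mscale (NngNum (f0 x)) (\d_x : {measure set X -> \bar R})))//.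
- apply: eq_integral => x _.
  by rewrite ge0_integral_mscale// integral_dirac// diracT mul1e.
- move=> U mU /=; rewrite /mscale/=.
  apply: emeasurable_funM; first exact/measurable_EFinP.
  by apply/measurable_EFinP; exact: measurable_indic.
- move=> U mU; rewrite integral_dirac// diracT mul1e PE// integral_mkcond.
  apply: eq_integral => x _; rewrite patchE.
  transitivity ((f x)%:E * (\1_U x)%:E)%E => //.
  by rewrite indicE; case: (x \in U); rewrite ?mule1 ?mule0.
Qed.

End density.

Lemma bounded_integrable d (X : measurableType d) (R : realType)
    (mu : {measure set X -> \bar R}) (f : X -> R) (K : R) :
  (mu setT < +oo)%E -> measurable_fun setT f -> (forall x, 0 <= f x <= K) ->
  mu.-integrable setT (EFin \o f).
Proof.
move=> muoo mf fK; apply: measurable_bounded_integrable => //.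
exists K; split; first exact: num_real.
move=> M KM x _ /=; have /andP[f0 fxK] := fK x.
by rewrite ger0_norm// (le_trans fxK)// ltW.
Qed.

Section weak_pinsker.
Context d (X : measurableType d) (R : realType).
Variables (P Q : {measure set X -> \bar R}) (f : X -> R).
Hypotheses (P1 : P setT = 1%E) (Q1 : Q setT = 1%E) (densf : is_density P Q f).

(* Optimizing over [l] turns this into [|E_Q phi - E_P phi| <= c sqrt (KL(P||Q))];
   the form linear in [KL] can be averaged over histories before optimizing. *)
Lemma weak_pinsker_density (phi : X -> R) (N : set X) (K m c l : R) :
  measurable_fun setT phi -> (forall x, 0 <= phi x <= K) ->
  measurable N -> Q N = 0%E -> (forall x, ~ N x -> m <= phi x <= m + c) ->
  0 < c -> 0 < l ->
  (((2 / c * (\int[Q]_x phi x - \int[P]_x phi x) - 1 / l) / l)%:E <=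
   \int[Q]_x (f x * ln (f x))%:E)%E.
Proof.
move=> mphi phiK mN QN0 phim c0 l0.
have [mf f0 PE] := densf.
have iphi : Q.-integrable setT (EFin \o phi).
  by apply: (bounded_integrable _ mphi phiK); rewrite Q1 ltry.
have iphiP : P.-integrable setT (EFin \o phi).
  by apply: (bounded_integrable _ mphi phiK); rewrite P1 ltry.
have phi0 x : 0 <= phi x by have /andP[] := phiK x.
have intf : (\int[Q]_x (f x)%:E = 1)%E by rewrite -PE.
have if_ : Q.-integrable setT (EFin \o f).
  apply/integrableP; split; first exact/measurable_EFinP.
  under eq_integral do rewrite /= ger0_norm//.
  by rewrite intf ltry.
have intfphi : (\int[Q]_x (f x * phi x)%:E = \int[P]_x (phi x)%:E)%E.
  by rewrite (integral_density densf)//; exact/measurable_EFinP.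
have mfphi : measurable_fun setT (fun x => f x * phi x) by exact: measurable_funM.
have ifphi : Q.-integrable setT (EFin \o (fun x => f x * phi x)).
  apply/integrableP; split; first exact/measurable_EFinP.
  under eq_integral do rewrite /= ger0_norm ?mulr_ge0//.
  rewrite intfphi.
  have /integrableP[_] := iphiP.
  by under eq_integral do rewrite /= ger0_norm//.
(* [u] is a lower bound for [f ln f] off [N]: [abs_entropy_bound] divided by [l], with [|1 - f|]
   replaced by [2 / c * (phi - (m + c / 2)) * (1 - f)]. Since [f] has integral 1, [b] cancels on
   integration and [- 2 e = - 1 / l^2] remains. *)
pose a := 2 / (c * l); pose b := a * (m + c / 2); pose e := 1 / (2 * l ^+ 2).
pose u x := a * phi x + ((- a) * (f x * phi x) + ((b - e + 1) * f x + (- b - e - 1))).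
have iZ k (g : X -> R) : Q.-integrable setT (EFin \o g) ->
    Q.-integrable setT (EFin \o (fun x => k * g x)).
  by move=> ig; exact: (integrableZl measurableT k ig).
have i4 : Q.-integrable setT (EFin \o cst (- b - e - 1)).
  apply/integrableP; split; first exact/measurable_EFinP.
  by rewrite /= integral_cst// Q1 mule1 ltry.
have i3 : Q.-integrable setT (EFin \o (fun x => (b - e + 1) * f x)) by exact: iZ.
have i34 : Q.-integrable setT (EFin \o (fun x => (b - e + 1) * f x + (- b - e - 1))).
  exact: (integrableD measurableT i3 i4).
have i2 : Q.-integrable setT (EFin \o (fun x => (- a) * (f x * phi x))) by exact: iZ.
have i234 : Q.-integrable setT (EFin \o
    (fun x => (- a) * (f x * phi x) + ((b - e + 1) * f x + (- b - e - 1)))).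
  exact: (integrableD measurableT i2 i34).
have i1 : Q.-integrable setT (EFin \o (fun x => a * phi x)) by exact: iZ.
have iu : Q.-integrable setT (EFin \o u) by exact: (integrableD measurableT i1 i234).
have intu : \int[Q]_x u x = a * \int[Q]_x phi x - a * \int[P]_x phi x
    + (b - e + 1) - b - e - 1.
  rewrite /u RintegralD// RintegralD// RintegralD// !RintegralZl//.
  rewrite (_ : \int[Q]_x (f x * phi x) = \int[P]_x phi x); last by rewrite /Rintegral intfphi.
  rewrite (_ : \int[Q]_x f x = 1); last by rewrite /Rintegral intf.
  rewrite (_ : \int[Q]_x (- b - e - 1) = - b - e - 1); last first.
    by rewrite /Rintegral integral_cst// Q1 mule1.
  by ring.
have -> : ((2 / c * (\int[Q]_x phi x - \int[P]_x phi x) - 1 / l) / l)%:E =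
    (\int[Q]_x (u x)%:E)%E.
  rewrite -(@fineK _ (\int[Q]_x (u x)%:E)%E); last exact: integrable_fin_num.
  rewrite [X in _ = X%:E]intu; congr (_%:E); rewrite /a /e.
  by field; rewrite !gt_eqF.
have mflnf : measurable_fun setT (fun x => f x * ln (f x)).
  by apply: measurable_funM => //; apply: measurableT_comp => //; exact: measurable_ln.
apply: ae_le_integral; first exact: measurable_int iu.
  by apply: measurable_funeneg; exact/measurable_EFinP.
have aeN : \forall x \ae Q, ~ N x by exists N; split => // x /= /contrapT.
apply: filterS aeN => x /phim/andP[mphix phixm]; rewrite lee_fin.
have := abs_entropy_bound (f0 x) l0; set A := `|_| => HA.
(* Off [N], [phi x] is within [c / 2] of the midpoint, so the factor in front of [1 - f x] has
   absolute value at most 1. *)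
have hphi : 2 / c * (phi x - (m + c / 2)) * (1 - f x) <= A.
  rewrite (le_trans (ler_norm _))// normrM ler_piMl//.
  rewrite ler_norml; apply/andP; split.
    by rewrite -ler_pdivrMl ?divr_gt0// invf_div (_ : c / 2 * -1 = - (c / 2)); lra.
  by rewrite -ler_pdivlMl ?divr_gt0// invf_div; lra.
have {hphi HA} : l^-1 * (2 / c * (phi x - (m + c / 2)) * (1 - f x)) <=
    l^-1 * (l * (f x * ln (f x) - f x + 1) + (f x + 1) / (2 * l)).
  by rewrite ler_pM2l ?invr_gt0//; exact: le_trans hphi HA.
have -> : l^-1 * (2 / c * (phi x - (m + c / 2)) * (1 - f x)) =
  a * phi x - a * (f x * phi x) + b * f x - b.
  by rewrite /b /a; field; rewrite !gt_eqF.
have -> : l^-1 * (l * (f x * ln (f x) - f x + 1) + (f x + 1) / (2 * l)) =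
  f x * ln (f x) - f x + 1 + e * f x + e.
  by rewrite /e; field; rewrite !gt_eqF.
by rewrite /u; lra.
Qed.

End weak_pinsker.

(** The bound holds for each density, hence for the infimum defining [KL]; without a density that
    infimum is [+oo]. *)
Lemma weak_pinsker d (X : measurableType d) (R : realType)
    (P Q : {measure set X -> \bar R}) (phi : X -> R) (N : set X) (K m c l : R) :
  P setT = 1%E -> Q setT = 1%E ->
  measurable_fun setT phi -> (forall x, 0 <= phi x <= K) ->
  measurable N -> Q N = 0%E -> (forall x, ~ N x -> m <= phi x <= m + c) ->
  0 < c -> 0 < l ->
  (((2 / c * (\int[Q]_x phi x - \int[P]_x phi x) - 1 / l) / l)%:E <= KL P Q)%E.
Proof.
move=> P1 Q1 mphi phiK mN QN0 phim c0 l0.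
by apply: le_ereal_inf_tmp => _ [f [densf ->]]; exact: weak_pinsker_density phim c0 l0.
Qed.

(** For the zero function and [c = 1], [weak_pinsker] reads [- 1 / l^2 <= KL P Q], and [l] may be
    taken arbitrarily large. *)
Lemma KL_ge0 d (X : measurableType d) (R : realType)
    (P Q : {measure set X -> \bar R}) :
  P setT = 1%E -> Q setT = 1%E -> (0 <= KL P Q)%E.
Proof.
move=> P1 Q1; apply/lee_addgt0Pr => e e0.
pose l := 1 + e^-1.
have e1 : 0 < e^-1 by rewrite invr_gt0.
have l1 : 1 < l by rewrite ltrDl.
have := @weak_pinsker _ _ _ P Q (cst 0) set0 0 0 1 l P1 Q1.
move=> /(_ (measurable_cst _)).
move=> /(_ _ measurable0 (measure0 _)) H.
rewrite -leeBlDr// add0e -EFinN.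
apply: le_trans (H _ _ _ _).
- rewrite lee_fin /Rintegral !integral0 subrr mulr0 sub0r mulNr lerN2 mul1r -invfM.
  rewrite invf_ple ?posrE// ?mulr_gt0 ?(lt_trans ltr01)//.
  by rewrite (@le_trans _ _ l)// ?ler_peMr ?(ltW (lt_trans ltr01 l1)) ?(ltW l1)// lerDr.
- by move=> x; rewrite lexx.
- by move=> x _; rewrite lexx add0r ler01.
- exact: ltr01.
- exact: lt_trans ltr01 l1.
Qed.

(** * The empirical quantile and the regret *)

Section empirical_quantile.
Context (R : realType) (T : nat) (gam : R).
Hypotheses (gam0 : 0 < gam) (gam1 : gam <= 1) (T0 : (0 < T)%N).

Definition ecdf (d : traj R T) (x : R) : R :=
  (\sum_(s < T) (nat_of_bool (tnth d s <= x)%R)%:R) / T%:R.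

Let T0R : 0 < T%:R :> R. Proof. by rewrite ltr0n. Qed.

Lemma ecdf_ge1 d x : (forall s, tnth d s <= x) -> ecdf d x = 1.
Proof.
move=> dx; rewrite /ecdf; under eq_bigr do rewrite dx.
by rewrite sumr_const card_ord divff// gt_eqF.
Qed.

Lemma ecdf_eq0 d x : (forall s, x < tnth d s) -> ecdf d x = 0.
Proof.
move=> dx; rewrite /ecdf big1 ?mul0r// => s _.
by rewrite leNgt dx.
Qed.

(* The quantile set is closed: its infimum is attained because the empirical
   distribution function is constant just to the right of any point. *)
Lemma xhat_le d x : (xhat gam d <= x) = (gam <= ecdf d x).
Proof.
pose S := [set x | gam <= ecdf d x].
pose M := \sum_(s < T) `|tnth d s|.
have dM s : `|tnth d s| <= M.
  by rewrite /M (bigD1 s)//= lerDl sumr_ge0.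
have S0 : S !=set0.
  by exists M; rewrite /S/= ecdf_ge1// => s; rewrite (le_trans (ler_norm _)).
have Slb : has_lbound S.
  exists (- M) => y Sy; rewrite leNgt; apply/negP => yM.
  move: Sy; rewrite /S/= ecdf_eq0; first by rewrite leNgt gam0.
  by move=> s; apply: lt_le_trans yM _; have := dM s; rewrite ler_norml => /andP[].
apply/idP/idP => [infx|Sx]; last exact: ge_inf.
have [y [xy yE]] : exists y, x < y /\ ecdf d y = ecdf d x.
  suff : \forall y \near x^'+, x < y /\ forall s, (tnth d s <= y) = (tnth d s <= x).
    move=> /filter_ex[y [xy yx]]; exists y; split => //.
    by rewrite /ecdf; under eq_bigr do rewrite yx.
  have H : \forall y \near x^'+, forall s, (tnth d s <= y) = (tnth d s <= x).
    apply: filter_forall => s; have [dx|xd] := leP (tnth d s) x.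
      by near=> y; apply: le_trans dx _; near: y; exact: nbhs_right_ge.
    by near=> y; apply/negbTE; rewrite -ltNge; near: y; exact: nbhs_right_lt.
  by near=> y; split; near: y; [exact: nbhs_right_gt|exact: H].
rewrite -yE; have [z Sz zy] := inf_lt S0 (le_lt_trans infx xy).
rewrite (le_trans Sz)// ler_pM2r ?invr_gt0//; apply: ler_sum => s _.
rewrite ler_nat; case: (leP (tnth d s) z) => //= dz.
by rewrite (le_trans dz (ltW zy)).
Unshelve. all: by end_near. Qed.

Lemma xhat_box B (d : traj R T) : box B d -> 0 <= xhat gam d <= B.
Proof.
move=> dB; apply/andP; split; last first.
  by rewrite xhat_le ecdf_ge1// => s; have /andP[] := dB s.
(* [xhat_le] is used at the point [xhat gam d] itself: were it negative, the empirical distribution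
   function there would be 0 and yet at least [gam]. *)
rewrite leNgt; apply/negP => x0; have := lexx (xhat gam d).
rewrite xhat_le ecdf_eq0; first by rewrite leNgt gam0.
by move=> s; have /andP[ds _] := dB s; exact: lt_le_trans x0 ds.
Qed.

(** By [xhat_le], the sublevel sets of [xhat] are defined by inequalities on finite sums of
    indicators. *)
Lemma measurable_xhat : measurable_fun setT (@xhat R T gam).
Proof.
apply: (measurability (@RGenOInfty.G R)); first exact: RGenOInfty.measurableE.
move=> _ [_ [x ->] <-]; rewrite setTI.
rewrite (_ : _ @^-1` _ = ~` [set d | gam <= ecdf d x]); last first.
  by apply/seteqP; split => d /=; rewrite in_itv/= andbT ltNge xhat_le => /negP.
apply: measurableC; rewrite -[X in measurable X]setTI.
apply: measurable_fun_le => //; apply: measurable_funM => //.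
apply: measurable_sum => s.
rewrite (_ : (fun d => _) = fun d : traj R T => if tnth d s <= x then 1 else 0); last first.
  by apply/funext => d; case: ifP.
apply: measurable_fun_ifT => //; apply: measurable_fun_ler => //.
exact: measurable_tnth.
Qed.

Lemma measurable_box B : measurable (@box R T B).
Proof.
rewrite (_ : box B = \bigcap_(s in [set: 'I_T]) [set d | 0 <= tnth d s <= B]); last first.
  by apply/seteqP; split => [d dB s _|d dB s]; exact: dB.
apply: fin_bigcap_measurable => // s _.
rewrite (_ : [set _ | _] = (fun d : traj R T => tnth d s) @^-1` `[0, B]); last first.
  by apply/seteqP; split => d /=; rewrite in_itv.
by rewrite -[X in measurable X]setTI; apply: measurable_tnth.
Qed.

End empirical_quantile.

Lemma nv_loss_ge0 (R : realType) (h b x d : R) : 0 < h -> 0 < b -> 0 <= nv_loss h b x d.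
Proof.
move=> h0 b0; rewrite /nv_loss.
by rewrite addr_ge0// mulr_ge0 ?(ltW h0) ?(ltW b0)// le_max lexx orbT.
Qed.

(** Raising the order from 0 to [x] adds at most [h x] of overage cost and cannot raise the underage
    cost. Integrated, this bounds the excess risk on [[0, B]]. *)
Lemma nv_loss_le (R : realType) (h b x d : R) : 0 < h -> 0 < b -> 0 <= x ->
  nv_loss h b x d <= h * x + nv_loss h b 0 d.
Proof.
move=> h0 b0 x0; rewrite /nv_loss sub0r subr0.
have : Num.max (x - d) 0 <= x + Num.max (- d) 0.
  rewrite ge_max; apply/andP; split; first by rewrite lerD2l le_max lexx.
  by rewrite addr_ge0// le_max lexx orbT.
have : Num.max (d - x) 0 <= Num.max d 0.
  by rewrite ge_max !le_max lexx orbT andbT; apply/orP; left; rewrite lerBlDr lerDl.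
move=> /(ler_wpM2l (ltW b0)) H1 /(ler_wpM2l (ltW h0)); rewrite mulrDr => H2; lra.
Qed.

Section excess_risk.
Context (R : realType) (T : nat) (Pstar : probability (traj R T) R) (t : 'I_T).
Variables (B h b : R) (fs : R -> R) (xs : R).
Hypotheses (B0 : 0 <= B) (h0 : 0 < h) (b0 : 0 < b).
Hypothesis fsE : forall x : R, 0 <= x <= B ->
  (\int[Pstar]_d (nv_loss h b x (tnth d t))%:E)%E = (fs x)%:E.
Hypotheses (xsB : 0 <= xs <= B) (xs_min : forall x, 0 <= x <= B -> fs xs <= fs x).

Let measurable_nv_loss : measurable_fun setT
  (fun p : R * traj R T => (nv_loss h b p.1 (tnth p.2 t))%:E).
Proof.
have mt : measurable_fun setT (fun p : R * traj R T => tnth p.2 t).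
  by apply: (@measurableT_comp _ _ _ _ _ _ (fun d : traj R T => tnth d t)) => //;
    exact: measurable_tnth.
apply/measurable_EFinP; apply: measurable_funD; apply: measurable_funM => //;
  apply: measurable_maxr => //; exact: measurable_funB.
Qed.

(* The regret is only controlled on [0, B]; outside of it [fs] need not even be
   measurable, hence the truncation. *)
Lemma truncated_excess_risk : exists (rho : R -> R) (K : R),
  [/\ measurable_fun setT rho, (forall x, 0 <= rho x <= K) &
      forall x, 0 <= x <= B -> rho x = fs x - fs xs].
Proof.
pose F x := (\int[Pstar]_d (nv_loss h b x (tnth d t))%:E)%E.
have mF : measurable_fun setT F.
  apply: (@measurable_fun_fubini_tonelli_F _ _ _ _ _ Pstar
    (fun p : R * traj R T => (nv_loss h b p.1 (tnth p.2 t))%:E)) => // p.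
  by rewrite lee_fin nv_loss_ge0.
pose I := fun x : R => (0 <= x) && (x <= B).
have m1 x : measurable_fun setT (fun d : traj R T => (nv_loss h b x (tnth d t))%:E).
  have mx : measurable_fun setT (fun d : traj R T => (x, d)) by exact: measurable_fun_pair.
  exact: (measurableT_comp measurable_nv_loss mx).
(* [F] is measurable on the whole line by Tonelli and agrees with [fs] on [[0, B]]. The upper bound
   comes from [nv_loss_le] and [fs xs >= 0]. *)
exists (fun x => if I x then fine (F x) - fs xs else 0), (h * B + fs 0); split.
- apply: measurable_fun_ifT => //.
    by apply: measurable_and; exact: measurable_fun_ler.
  by apply: measurable_funB => //; apply: measurableT_comp => //; exact: fine_measurable.
- have fs0 x : 0 <= x <= B -> 0 <= fs x.
    move=> xB; rewrite -lee_fin -fsE//; apply: integral_ge0 => d _.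
    by rewrite lee_fin nv_loss_ge0.
  have zB : (0 : R) <= 0 <= B by apply/andP; split.
  move=> x; case: ifPn => [xB|_]; last by rewrite lexx addr_ge0 ?mulr_ge0 ?(ltW h0) ?fs0.
  rewrite /F fsE//= subr_ge0 xs_min//= lerBlDr.
  rewrite (@le_trans _ _ (h * B + fs 0))//; last by rewrite lerDl fs0.
  rewrite -lee_fin EFinD -!fsE//.
  have -> : (h * B)%:E = (\int[Pstar]_d (h * B)%:E)%E.
    by rewrite integral_cst//= [X in (_ * X)%E]probability_setT mule1.
  have /andP[x0 xleB] := xB.
  rewrite -ge0_integralD//; last 2 first.
  + by move=> d _; rewrite lee_fin mulr_ge0// ltW.
  + by move=> d _; rewrite lee_fin nv_loss_ge0.
  apply: ge0_le_integral => //.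
  + by move=> d _; rewrite lee_fin nv_loss_ge0.
  + by apply: emeasurable_funD.
  + move=> d _; rewrite -EFinD lee_fin (le_trans (nv_loss_le _ h0 b0 x0))//.
    by rewrite lerD2r ler_pM2l.
- by move=> x xB; rewrite /I xB /F fsE.
Qed.

End excess_risk.

(** * The law of the interaction *)

Section histories.
Context (R : realType) (T : nat) (gam : R).
Hypotheses (gam0 : 0 < gam) (gam1 : gam <= 1) (T0 : (0 < T)%N).

Notation pasts := (traj R T * T.-tuple (traj R T))%type.

(** The policy acts on the history, whereas the interaction is conditioned on the whole past; this
    map turns kernels on histories into kernels on pasts. *)
Definition hist_of_past (t : 'I_T) (y : pasts) : hist R T :=
  [tuple (if (s < t)%N
          then (xhat gam (tnth y.2 s), psi (xhat gam (tnth y.2 s)) (tnth y.1 s))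
          else hdef R) | s < T].

Lemma histoE d (Om : measurableType d) (D : Om -> traj R T)
    (Dt : 'I_T -> Om -> traj R T) t w :
  histo gam D Dt t w = hist_of_past t (past D Dt t w).
Proof.
apply: eq_from_tnth => s; rewrite !tnth_mktuple /=.
by case: ifPn => // st; rewrite tnth_mktuple st.
Qed.

Lemma measurable_hist_of_past t : measurable_fun setT (hist_of_past t).
Proof.
apply/measurable_fun_tnthP => s.
rewrite (_ : _ \o _ = fun y : pasts => if (s < t)%N
    then (xhat gam (tnth y.2 s), psi (xhat gam (tnth y.2 s)) (tnth y.1 s))
    else hdef R); last by apply/funext => y; rewrite /= tnth_mktuple.
case: (s < t)%N; last exact: measurable_cst.
have m1 : measurable_fun setT (fun y : pasts => tnth y.1 s).
  by apply: (@measurableT_comp _ _ _ _ _ _ (fun d : traj R T => tnth d s)) => //;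
    exact: measurable_tnth.
have m2 : measurable_fun setT (fun y : pasts => xhat gam (tnth y.2 s)).
  apply: measurableT_comp; first exact: measurable_xhat.
  by apply: (@measurableT_comp _ _ _ _ _ _ (fun e : T.-tuple (traj R T) => tnth e s)) => //;
    exact: measurable_tnth.
apply: measurable_fun_pair => //; apply: measurable_fun_pair => /=.
  exact: measurable_minr.
exact: measurable_fun_ler.
Qed.

Lemma is_hist_of_past B (t : 'I_T) (y : pasts) : box B y.1 ->
  (forall s : 'I_T, (s < t)%N -> box B (tnth y.2 s)) -> is_hist B t (hist_of_past t y).
Proof.
move=> yB eB s; rewrite tnth_mktuple; case: (boolP (s < t)%N) => //= st.
have xB := xhat_box gam0 gam1 T0 (eB s st).
have /andP[x0 xB'] := xB; have /andP[y0 yB'] := yB s.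
by split => //; rewrite /psi/= le_min ge_min y0 x0 yB'.
Qed.

(** The one-round transition: filling slot [t] with the new completion yields the next past, which
    drives the induction over rounds. *)
Definition past_update (t : 'I_T) (yz : pasts * traj R T) : pasts :=
  (yz.1.1, [tuple (if s == t then yz.2 else tnth yz.1.2 s) | s < T]).

Lemma measurable_past_update t : measurable_fun setT (past_update t).
Proof.
apply: measurable_fun_pair; first exact: measurableT_comp.
apply/measurable_fun_tnthP => s.
rewrite (_ : _ \o _ = fun yz : pasts * traj R T => if s == t then yz.2 else tnth yz.1.2 s);
  last by apply/funext => y; rewrite /= tnth_mktuple.
case: (s == t); first exact: measurable_snd.
have m12 : measurable_fun setT (fun yz : pasts * traj R T => yz.1.2).
  by apply: (measurableT_comp (f := snd)).
have mt : measurable_fun setT (fun e : T.-tuple (traj R T) => tnth e s).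
  exact: measurable_tnth.
exact: (measurableT_comp mt m12).
Qed.

Lemma past_succ d (Om : measurableType d) (D : Om -> traj R T)
    (Dt : 'I_T -> Om -> traj R T) (t t' : 'I_T) w : t' = t.+1 :> nat ->
  past D Dt t' w = past_update t (past D Dt t w, Dt t w).
Proof.
move=> t't; congr pair; apply: eq_from_tnth => s; rewrite !tnth_mktuple /=.
rewrite t't ltnS leq_eqVlt -[s == t](inj_eq val_inj).
by case: (eqVneq (val s) (val t)) => [/val_inj ->|].
Qed.

Lemma past0 d (Om : measurableType d) (D : Om -> traj R T)
    (Dt : 'I_T -> Om -> traj R T) (t : 'I_T) w : t = 0%N :> nat ->
  past D Dt t w = (D w, [tuple trajdef R T | s < T]).
Proof.
move=> t0; congr pair; apply: eq_from_tnth => s; rewrite !tnth_mktuple.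
by rewrite t0 ltn0.
Qed.

Lemma measurable_past d (Om : measurableType d) (D : Om -> traj R T)
    (Dt : 'I_T -> Om -> traj R T) t : measurable_fun setT D ->
  (forall s, measurable_fun setT (Dt s)) -> measurable_fun setT (past D Dt t).
Proof.
move=> mD mDt; apply: measurable_fun_pair => //; apply/measurable_fun_tnthP => s.
rewrite (_ : _ \o _ = fun w => if (s < t)%N then Dt s w else trajdef R T);
  last by apply/funext => y; rewrite /= tnth_mktuple.
by case: (s < t)%N.
Qed.

End histories.

Lemma ge0_integral_eq0_ae d (X : measurableType d) (R : realType)
    (mu : {measure set X -> \bar R}) (f : X -> \bar R) :
  measurable_fun setT f -> (forall x, 0 <= f x)%E ->
  (\int[mu]_x f x = 0)%E -> \forall x \ae mu, f x = 0%E.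
Proof.
move=> mf f0 intf.
have /(ae_eq_integral_abs mu measurableT mf) : (\int[mu]_x `|f x| = 0)%E.
  by rewrite -intf; apply: eq_integral => x _; rewrite gee0_abs.
by apply: filterS => x; exact.
Qed.

Lemma ae_measure0 d (X : measurableType d) (R : realType)
    (mu : {measure set X -> \bar R}) (N : set X) :
  measurable N -> (\forall x \ae mu, ~ N x) -> mu N = 0%E.
Proof.
move=> mN [M [mM M0 NM]]; apply: (subset_measure0 mN mM _ M0) => x Nx.
by apply: NM => /=; exact.
Qed.

Lemma null_set_ae d (X : measurableType d) (R : realType)
    (mu : {measure set X -> \bar R}) (N : set X) :
  measurable N -> mu N = 0%E -> \forall x \ae mu, ~ N x.
Proof. by move=> mN N0; exists N; split => // x /= /contrapT. Qed.

Section interaction_law.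
Context (R : realType) (T : nat) (gam : R).
Hypotheses (gam0 : 0 < gam) (gam1 : gam <= 1) (T0 : (0 < T)%N).
Context d (Om : measurableType d) (P : probability Om R).
Variables (Pstar : probability (traj R T) R) (D : Om -> traj R T)
  (Dt : 'I_T -> Om -> traj R T) (Q : 'I_T -> R.-pker (hist R T) ~> traj R T).
Hypothesis int : interaction gam D Dt P Pstar Q.

Lemma interaction_measurable_past t : measurable_fun setT (past D Dt t).
Proof. by have [mD mDt _ _] := int; exact: measurable_past. Qed.

Lemma interaction_measurable_histo t : measurable_fun setT (histo gam D Dt t).
Proof.
rewrite (_ : histo _ _ _ _ = hist_of_past gam t \o past D Dt t); last first.
  by apply/funext => w; rewrite histoE.
apply: measurableT_comp; first exact: measurable_hist_of_past.
exact: interaction_measurable_past.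
Qed.

Notation kpast t := (kpull (Q t) (measurable_hist_of_past gam0 gam1 T0 t)).

Let kpastP t A F : measurable A -> measurable F ->
  (P (past D Dt t @^-1` A `&` Dt t @^-1` F) =
   \int[P]_(w in past D Dt t @^-1` A) kpast t (past D Dt t w) F)%E.
Proof.
move=> mA mF; have [_ _ _ H] := int; apply: etrans (H t A F mA mF) _.
by apply: eq_integral => w _; rewrite /kpull -histoE.
Qed.

Lemma interaction_set t (N : set ((traj R T * T.-tuple (traj R T)) * traj R T)) :
  measurable N ->
  (P [set w | N (past D Dt t w, Dt t w)] =
   \int[P]_w Q t (histo gam D Dt t w) (xsection N (past D Dt t w)))%E.
Proof.
move=> mN; have [mD mDt _ _] := int.
rewrite (disintegration_set (interaction_measurable_past t) (mDt t) (@kpastP t) mN).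
by apply: eq_integral => w _; rewrite histoE.
Qed.

Lemma interaction_fun t A (f : traj R T -> \bar R) : measurable A ->
  (forall z, 0 <= f z)%E -> measurable_fun setT f ->
  (\int[P]_(w in histo gam D Dt t @^-1` A) f (Dt t w) =
   \int[P]_(w in histo gam D Dt t @^-1` A) \int[Q t (histo gam D Dt t w)]_z f z)%E.
Proof.
move=> mA f0 mf; have [mD mDt _ _] := int.
have mh := measurable_hist_of_past gam0 gam1 T0 t.
have mhA : measurable (hist_of_past gam t @^-1` A).
  by rewrite -[X in measurable X]setTI; exact: mh.
have -> : histo gam D Dt t @^-1` A = past D Dt t @^-1` (hist_of_past gam t @^-1` A).
  by apply/seteqP; split => w /=; rewrite histoE.
apply: etrans (disintegration_fun (interaction_measurable_past t) (mDt t)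
  (@kpastP t) mhA f0 mf) _.
by apply: eq_integral => w _; rewrite histoE.
Qed.

Lemma interaction_marginal t F : measurable F ->
  (P (Dt t @^-1` F) = \int[P]_w Q t (histo gam D Dt t w) F)%E.
Proof.
move=> mF; have [_ _ _ /(_ t setT F measurableT mF)] := int.
by rewrite preimage_setT setTI.
Qed.

(** The probability that [Dt t] lies in [F] is the integral of the nonnegative function
    [Q t (histo gam D Dt t w) F]; both sides say that it vanishes. *)
Lemma interaction_ae_kernel t F : measurable F ->
  (\forall w \ae P, ~ F (Dt t w)) <->
  \forall w \ae P, Q t (histo gam D Dt t w) F = 0%E.
Proof.
move=> mF; have [mD mDt _ _] := int.
have mF' : measurable (Dt t @^-1` F) by rewrite -[X in measurable X]setTI; exact: mDt.
have mQ : measurable_fun setT (fun w => Q t (histo gam D Dt t w) F).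
  by apply: (measurableT_comp (measurable_kernel (Q t) F mF));
    exact: interaction_measurable_histo.
split => [/(ae_measure0 mF') F0|Q0].
  apply: (ge0_integral_eq0_ae mQ) => //.
  exact: etrans (esym (interaction_marginal t mF)) F0.
apply: (null_set_ae mF'); apply: etrans (interaction_marginal t mF) _.
by rewrite (ae_eq_integral_nonmeasurable (g := cst 0%E)) ?integral0.
Qed.

Lemma interaction_box B : Pstar (box (T:=T) B) = 1%E ->
  \forall w \ae P, box B (D w).
Proof.
move=> PB; have [mD _ DP _] := int; have mB := @measurable_box R T B.
have mBC := measurableC mB.
have : P (D @^-1` (~` box B)) = 0%E.
  by rewrite DP// probability_setC// PB subee.
move=> /(null_set_ae _) H.
have {}/H : measurable (D @^-1` (~` box B)).
  by rewrite -[X in measurable X]setTI; exact: mD.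
by apply: filterS => w /= /contrapT.
Qed.

End interaction_law.

Section completions_in_box.
Context (R : realType) (T : nat) (gam B : R).
Hypotheses (gam0 : 0 < gam) (gam1 : gam <= 1) (T0 : (0 < T)%N).
Context d (Om : measurableType d) (P : probability Om R).
Variables (Pstar : probability (traj R T) R) (D : Om -> traj R T)
  (Dt : 'I_T -> Om -> traj R T) (Q : 'I_T -> R.-pker (hist R T) ~> traj R T).
Hypothesis Pbox : Pstar (box (T:=T) B) = 1%E.
Hypothesis intP : interaction gam D Dt P Pstar Q.

Let mBC : measurable (~` box (T:=T) B).
Proof. by apply: measurableC; exact: measurable_box. Qed.

(** When [Q] is both the sampling kernel and the conditional law of [D], the completion and [D] have
    the same marginal law, so the completion inherits the support of [Pstar]. *)
Lemma cond_law_completion_box t : is_cond_law gam D Dt P Q ->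
  \forall w \ae P, box B (Dt t w).
Proof.
move=> condP.
have : \forall w \ae P, ~ (~` box B) (Dt t w).
  have [mD mDt DP _] := intP.
  have mDtB : measurable (Dt t @^-1` (~` box B)).
    by rewrite -[X in measurable X]setTI; exact: mDt.
  apply: (null_set_ae mDtB).
  apply: etrans (interaction_marginal intP t mBC) _.
  have := condP t setT _ measurableT mBC; rewrite preimage_setT setTI => <-.
  rewrite DP//; apply: etrans (probability_setC _ _) _; first exact: measurable_box.
  by rewrite Pbox subee.
by apply: filterS => w /contrapT.
Qed.

Lemma histo_is_hist_ae (t : 'I_T) :
  (forall s : 'I_T, (s < t)%N -> \forall w \ae P, box B (Dt s w)) ->
  \forall w \ae P, is_hist B t (histo gam D Dt t w).
Proof.
move=> Hs.
have H : \forall w \ae P, forall s : 'I_T, (s < t)%N -> box B (Dt s w).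
  apply: filter_forall => s; have [st|ts] := boolP (s < t)%N.
    by apply: filterS (Hs s st) => w.
  by apply: filterE.
near=> w.
rewrite histoE; apply: is_hist_of_past => //=.
  by near: w; exact: interaction_box intP _ Pbox.
move=> s st; rewrite tnth_mktuple st; move: (s) st; near: w.
exact: H.
Unshelve. all: by end_near. Qed.

(** Strong induction on the round: the support of [Q] is controlled only at valid histories, and a
    history is valid once all earlier completions lie in the box. *)
Lemma completion_box (t : 'I_T) :
  (forall (t : 'I_T) (hi : hist R T), is_hist B t hi -> Q t hi (box (T:=T) B) = 1%E) ->
  \forall w \ae P, box B (Dt t w).
Proof.
move=> Qbox; have [n] := ubnP (t : nat); elim: n t => // n IH t tn.
have H : \forall w \ae P, is_hist B t (histo gam D Dt t w).
  by apply: histo_is_hist_ae => s st; apply: IH; exact: leq_trans st tn.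
have : \forall w \ae P, ~ (~` box B) (Dt t w).
  apply/(interaction_ae_kernel gam0 gam1 T0 intP t mBC).
  apply: filterS H => w /Qbox Q1.
  have mB := @measurable_box R T B.
  have QT : Q t (histo gam D Dt t w) setT = 1%E by exact: prob_kernel.
  have : (1 = 1 + Q t (histo gam D Dt t w) (~` box (T:=T) B))%E.
    rewrite -[X in (_ = X + _)%E]Q1 -[LHS]QT -[in LHS](setUCr (box (T:=T) B)).
    by apply: measureU => //; exact: setICr.
  case: (Q t _ _) (measure_ge0 (Q t (histo gam D Dt t w)) (~` box B)) => //= r _ [].
  by move=> /eqP; rewrite -subr_eq0 opprD addrA subrr sub0r oppr_eq0 => /eqP ->.
by apply: filterS => w /contrapT.
Qed.

End completions_in_box.

(** * Domination of the deployed law by the ideal law *)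

Section absolute_continuity.
Context (R : realType) (T : nat) (gam B : R).
Hypotheses (gam0 : 0 < gam) (gam1 : gam <= 1) (T0 : (0 < T)%N).
Context d1 (Om1 : measurableType d1) (P1 : probability Om1 R).
Context d2 (Om2 : measurableType d2) (P2 : probability Om2 R).
Variables (Pstar : probability (traj R T) R).
Variables (D1 : Om1 -> traj R T) (Dt1 : 'I_T -> Om1 -> traj R T).
Variables (D2 : Om2 -> traj R T) (Dt2 : 'I_T -> Om2 -> traj R T).
Variables (Q1 Q2 : 'I_T -> R.-pker (hist R T) ~> traj R T).
Hypothesis int1 : interaction gam D1 Dt1 P1 Pstar Q1.
Hypothesis int2 : interaction gam D2 Dt2 P2 Pstar Q2.
Hypothesis hist2 : forall t, \forall w \ae P2, is_hist B t (histo gam D2 Dt2 t w).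
Hypothesis Q21 : forall (t : 'I_T) (hi : hist R T), is_hist B t hi ->
  forall F, measurable F -> Q1 t hi F = 0%E -> Q2 t hi F = 0%E.

(* Round by round, a null set of (past, completion) pairs under the first law
   has null sections under [Q1] for almost every past, hence under [Q2]. *)
Lemma past_dominates (t : 'I_T) N : measurable N ->
  P1 (past D1 Dt1 t @^-1` N) = 0%E -> P2 (past D2 Dt2 t @^-1` N) = 0%E.
Proof.
case: t => n; elim: n N => [|n IH] N nT mN.
  (* Before the first round the past is [D] with default padding, so its law is determined by
     [Pstar] alone. *)
  have base d (Om : measurableType d) (P : probability Om R) D Dt Q :
      interaction gam D Dt P Pstar Q ->
      P (past D Dt (Ordinal nT) @^-1` N) =
      Pstar [set x | N (x, [tuple trajdef R T | s < T])].
    move=> [mD mDt DP _]; rewrite -DP.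
      by congr (P _); apply/seteqP; split => w /=; rewrite past0.
    have mx : measurable_fun setT (fun x : traj R T => (x, [tuple trajdef R T | s < T])).
      exact: measurable_fun_pair.
    by rewrite -[X in measurable X]setTI; exact: mx.
  by rewrite (base _ _ _ _ _ _ int1) (base _ _ _ _ _ _ int2).
pose t := Ordinal (ltnW nT : (n < T)%N).
pose N' := past_update t @^-1` N.
have mN' : measurable N'.
  by rewrite -[X in measurable X]setTI; exact: measurable_past_update.
have step d (Om : measurableType d) (P : probability Om R) D Dt Q :
    interaction gam D Dt P Pstar Q ->
    P (past D Dt (Ordinal nT) @^-1` N) =
    (\int[P]_w Q t (histo gam D Dt t w) (xsection N' (past D Dt t w)))%E.
  move=> intP; transitivity (P [set w | N' (past D Dt t w, Dt t w)]); last first.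
    exact: (interaction_set gam0 gam1 T0 intP t mN').
  congr (P _); apply/seteqP; split => w /=;
  by rewrite /N'/= (@past_succ _ _ _ _ _ _ t (Ordinal nT)).
have mh := measurable_hist_of_past gam0 gam1 T0 t.
(* The vanishing integral of [psi1] makes [M] a null set of pasts under the first law; the induction
   hypothesis carries this to the second. Off [M], [Q21] annihilates the sections under [Q2] as
   well. *)
pose psi1 y := Q1 t (hist_of_past gam t y) (xsection N' y).
have mpsi1 : measurable_fun setT psi1.
  by apply: (measurable_fun_xsection_finite_kernel (kpull (Q1 t) mh)); rewrite inE.
pose M := [set y | psi1 y != 0%E].
have mM : measurable M.
  by rewrite -[X in measurable X]setTI; exact: emeasurable_neq.
rewrite (step _ _ _ _ _ _ int1) (step _ _ _ _ _ _ int2) => int0.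
have mpast1 := interaction_measurable_past int1 t.
have mpast2 := interaction_measurable_past int2 t.
have M1 : P1 (past D1 Dt1 t @^-1` M) = 0%E.
  apply: ae_measure0; first by rewrite -[X in measurable X]setTI; exact: mpast1.
  have : \forall w \ae P1, (psi1 \o past D1 Dt1 t) w = 0%E.
    have mpsi1p : measurable_fun setT (psi1 \o past D1 Dt1 t) by exact: measurableT_comp.
    apply: (ge0_integral_eq0_ae mpsi1p); first by move=> w; exact: measure_ge0.
    apply: etrans int0; apply: eq_integral => w _.
    by rewrite /psi1/= -histoE.
  by apply: filterS => w /= H; apply/negP; rewrite negbK; apply/eqP.
have M2 := IH M (ltnW nT) mM M1.
have {}M2 : \forall w \ae P2, ~ M (past D2 Dt2 t w).
  by apply: null_set_ae M2; rewrite -[X in measurable X]setTI; exact: mpast2.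
rewrite (ae_eq_integral_nonmeasurable (g := cst 0%E)) ?integral0//.
apply: filterS2 M2 (hist2 t) => w Mw hw.
apply: Q21 => //; first exact: measurable_xsection.
by move: Mw; rewrite /M/= /psi1 -histoE => /negP; rewrite negbK => /eqP.
Qed.

Lemma histo_dominates (t : 'I_T) A : measurable A ->
  P1 (histo gam D1 Dt1 t @^-1` A) = 0%E -> P2 (histo gam D2 Dt2 t @^-1` A) = 0%E.
Proof.
move=> mA.
have mhA : measurable (hist_of_past gam t @^-1` A).
  rewrite -[X in measurable X]setTI.
  exact: (measurable_hist_of_past gam0 gam1 T0 t).
have := @past_dominates t _ mhA.
rewrite (_ : past D1 Dt1 t @^-1` _ = histo gam D1 Dt1 t @^-1` A); last first.
  by apply/seteqP; split => w /=; rewrite histoE.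
rewrite (_ : past D2 Dt2 t @^-1` _ = histo gam D2 Dt2 t @^-1` A)//.
by apply/seteqP; split => w /=; rewrite histoE.
Qed.

End absolute_continuity.

(** * Conditional mean regret given the history *)

Section kernel_average.
Context d1 d2 (X : measurableType d1) (Y : measurableType d2) (R : realType).
Variables (k : R.-pker X ~> Y) (phi : Y -> R) (K : R).
Hypotheses (mphi : measurable_fun setT phi) (phiK : forall y, 0 <= phi y <= K).

Let phi0 y : 0 <= phi y. Proof. by have /andP[] := phiK y. Qed.

Lemma kernel_averageE x : (\int[k x]_y (phi y)%:E)%E = (\int[k x]_y phi y)%:E.
Proof.
rewrite fineK//; apply: integrable_fin_num => //.
by apply: (bounded_integrable _ mphi phiK); rewrite prob_kernel ltry.
Qed.

Lemma kernel_average_bound x : 0 <= \int[k x]_y phi y <= K.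
Proof.
rewrite -!lee_fin -kernel_averageE; apply/andP; split.
  by apply: integral_ge0 => y _; rewrite lee_fin.
apply: (@le_trans _ _ (\int[k x]_y K%:E)%E).
  apply: ge0_le_integral => //.
  - by move=> y _; rewrite lee_fin.
  - exact/measurable_EFinP.
  - by move=> y _; rewrite lee_fin; have /andP[] := phiK y.
by rewrite integral_cst// prob_kernel mule1.
Qed.

Lemma measurable_kernel_average : measurable_fun setT (fun x => \int[k x]_y phi y).
Proof.
apply: measurableT_comp; first exact: fine_measurable.
apply: measurable_fun_integral_kernel.
- by move=> U mU; exact: measurable_kernel.
- by move=> y; rewrite lee_fin.
- exact/measurable_EFinP.
Qed.

End kernel_average.

(** The kernel average [G] of [phi] at the history is a conditional mean of [Y], as is the constant
    [c]. On the event [c < G] they have equal integrals although the difference is positive there,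
    so the event is null. *)
Lemma cexp_const_average_le (R : realType) (T : nat) (gam : R)
    d (Om : measurableType d) (P : probability Om R)
    (Pstar : probability (traj R T) R) (D : Om -> traj R T)
    (Dt : 'I_T -> Om -> traj R T) (Q : 'I_T -> R.-pker (hist R T) ~> traj R T)
    (t : 'I_T) (Y : Om -> R) (phi : traj R T -> R) (K c : R) :
  0 < gam -> gam <= 1 -> (0 < T)%N -> interaction gam D Dt P Pstar Q ->
  measurable_fun setT phi -> (forall z, 0 <= phi z <= K) ->
  (\forall w \ae P, Y w = phi (Dt t w)) ->
  cexp_version P Y (histo gam D Dt t) (fun _ => c) ->
  P (histo gam D Dt t @^-1` [set hi | c < \int[Q t hi]_z phi z]) = 0%E.
Proof.
move=> gam0 gam1 T0 intP mphi phiK Yphi [_ condY].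
pose G hi := \int[Q t hi]_z phi z; pose A := [set hi | c < G hi].
have mG : measurable_fun setT G by exact: measurable_kernel_average mphi phiK.
have mA : measurable A.
  rewrite -[X in measurable X]setTI (_ : A = G @^-1` `]c, +oo[); first exact: mG.
  by apply/seteqP; split => hi /=; rewrite in_itv/= andbT.
pose H := histo gam D Dt t.
have mH : measurable_fun setT H by exact: (interaction_measurable_histo gam0 gam1 T0 intP).
have mHA : measurable (H @^-1` A) by rewrite -[X in measurable X]setTI; exact: mH.
have [_ mDt _ _] := intP.
have mGH : measurable_fun setT (fun w => G (H w)) by exact: measurableT_comp.
have iGH : P.-integrable (H @^-1` A) (EFin \o (fun w => G (H w))).
  apply: (@integrableS _ _ _ _ setT) => //.
  apply: (bounded_integrable _ mGH (K := K)).
    by rewrite [X in (X < _)%E]probability_setT ltry.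
  by move=> w; exact: kernel_average_bound mphi phiK _.
have ic : P.-integrable (H @^-1` A) (EFin \o cst c) by exact: finite_measure_integrable_cst.
(* From the constant to [Y], from [Y] to [phi] of the completion, and from there to its kernel
   average. *)
have EGc : (\int[P]_(w in H @^-1` A) (G (H w))%:E = \int[P]_(w in H @^-1` A) c%:E)%E.
  rewrite condY//.
  rewrite (@ae_eq_integral_nonmeasurable _ _ _ P (H @^-1` A) (EFin \o Y)
    (fun w => (phi (Dt t w))%:E))//; last 2 first.
  - by apply/measurable_EFinP; exact: measurableT_comp.
  - by apply: filterS Yphi => w /= ->.
  rewrite (interaction_fun gam0 gam1 T0 intP t mA (f := EFin \o phi)).
  - by apply: eq_integral => w _; rewrite (kernel_averageE _ mphi phiK).
  - by move=> z; rewrite lee_fin; have /andP[] := phiK z.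
  - exact/measurable_EFinP.
pose f := (fun w => (G (H w))%:E - c%:E)%E \_ (H @^-1` A).
have f0 w : (0 <= f w)%E.
  rewrite /f patchE; case: ifPn => // /set_mem Aw.
  by rewrite -EFinB lee_fin subr_ge0 ltW.
have mf : measurable_fun setT f.
  apply/(measurable_restrictT _ mHA); apply: measurable_funTS.
  by apply: emeasurable_funB => //; exact/measurable_EFinP.
have : (\int[P]_w f w = 0)%E.
  rewrite -integral_mkcond integralB// EGc subee// integrable_fin_num//.
move=> /(ge0_integral_eq0_ae mf f0) fae.
apply: (ae_measure0 mHA); apply: filterS fae => w + Aw.
rewrite /f patchE mem_set// -EFinB => -[] /eqP; rewrite subr_eq0 => /eqP E.
by move: Aw; rewrite /A/= /preimage/= E ltxx.
Qed.

Section bounded_reward.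
Context (R : realType) (T : nat) (gam : R).
Hypotheses (gam0 : 0 < gam) (gam1 : gam <= 1) (T0 : (0 < T)%N).
Context d (Om : measurableType d) (P : probability Om R).
Variables (Pstar : probability (traj R T) R) (D : Om -> traj R T)
  (Dt : 'I_T -> Om -> traj R T) (Q : 'I_T -> R.-pker (hist R T) ~> traj R T).
Hypothesis intP : interaction gam D Dt P Pstar Q.
Variables (phi : traj R T -> R) (K : R) (t : 'I_T) (Y : Om -> R).
Hypotheses (mphi : measurable_fun setT phi) (phiK : forall z, 0 <= phi z <= K).
Hypothesis Yphi : \forall w \ae P, Y w = phi (Dt t w).

Let mphiDt : measurable_fun setT (phi \o Dt t).
Proof. by have [_ mDt _ _] := intP; exact: measurableT_comp. Qed.

Lemma reward_integrable : P.-integrable setT (EFin \o (phi \o Dt t)).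
Proof.
apply: (bounded_integrable _ mphiDt (K := K)); last by move=> w; exact: phiK.
by rewrite [X in (X < _)%E]probability_setT ltry.
Qed.

Lemma reward_integralE : (\int[P]_w (Y w)%:E = (\int[P]_w phi (Dt t w))%:E)%E.
Proof.
rewrite fineK; last by apply: integrable_fin_num => //; exact: reward_integrable.
apply: (@ae_eq_integral_nonmeasurable _ _ _ P setT (EFin \o Y)) => //.
  exact/measurable_EFinP.
by apply: filterS Yphi => w /= ->.
Qed.

Lemma measurable_average_histo :
  measurable_fun setT (fun w => \int[Q t (histo gam D Dt t w)]_z phi z).
Proof.
have mG : measurable_fun setT (fun hi => \int[Q t hi]_z phi z).
  exact: measurable_kernel_average mphi phiK.
apply: (measurableT_comp mG).
exact: (interaction_measurable_histo gam0 gam1 T0 intP).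
Qed.

Lemma average_histo_integrable :
  P.-integrable setT (EFin \o (fun w => \int[Q t (histo gam D Dt t w)]_z phi z)).
Proof.
apply: (bounded_integrable _ measurable_average_histo (K := K)).
  by rewrite [X in (X < _)%E]probability_setT ltry.
by move=> w; exact: kernel_average_bound mphi phiK _.
Qed.

Lemma reward_average : \int[P]_w phi (Dt t w) =
  \int[P]_w \int[Q t (histo gam D Dt t w)]_z phi z.
Proof.
rewrite /Rintegral; congr fine.
have := interaction_fun gam0 gam1 T0 intP t measurableT (f := EFin \o phi).
rewrite preimage_setT => ->.
- by apply: eq_integral => w _; rewrite -(kernel_averageE _ mphi phiK).
- by move=> z; rewrite lee_fin; have /andP[] := phiK z.
- exact/measurable_EFinP.
Qed.

End bounded_reward.

(** * The comparison in a single round *)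

Section round.
Context (R : realType) (T : nat) (gam : R).
Hypotheses (gam0 : 0 < gam) (gam1 : gam <= 1) (T0 : (0 < T)%N).
Context d1 (Om1 : measurableType d1) (P1 : probability Om1 R).
Context d2 (Om2 : measurableType d2) (P2 : probability Om2 R).
Variables (Pstar : probability (traj R T) R).
Variables (D1 : Om1 -> traj R T) (Dt1 : 'I_T -> Om1 -> traj R T).
Variables (D2 : Om2 -> traj R T) (Dt2 : 'I_T -> Om2 -> traj R T).
Variables (Q1 Q2 : 'I_T -> R.-pker (hist R T) ~> traj R T).
Hypothesis int1 : interaction gam D1 Dt1 P1 Pstar Q1.
Hypothesis int2 : interaction gam D2 Dt2 P2 Pstar Q2.
Variables (phi : traj R T -> R) (K : R) (t : 'I_T).
Variables (Y1 : Om1 -> R) (Y2 : Om2 -> R) (m c : R).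
Hypotheses (mphi : measurable_fun setT phi) (phiK : forall z, 0 <= phi z <= K).
Hypothesis Y1phi : \forall w \ae P1, Y1 w = phi (Dt1 t w).
Hypothesis Y2phi : \forall w \ae P2, Y2 w = phi (Dt2 t w).
Hypothesis condY1 : cexp_version P1 Y1 (histo gam D1 Dt1 t)
  (fun _ => fine (\int[P1]_w (Y1 w)%:E)%E).
Hypothesis dom : forall A, measurable A ->
  P1 (histo gam D1 Dt1 t @^-1` A) = 0%E -> P2 (histo gam D2 Dt2 t @^-1` A) = 0%E.
Hypotheses (c0 : 0 < c) (Y2m : \forall w \ae P2, m <= Y2 w <= m + c).

Let e1 := \int[P1]_w phi (Dt1 t w).
Let e2 := \int[P2]_w phi (Dt2 t w).

(** At almost every deployed history [weak_pinsker] bounds [G2 - G1], and [G1 <= e1] holds there by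
    domination. Integrating over histories turns [G2] into [e2]. *)
Lemma round_bound l : 0 < l ->
  (((2 / c * (e2 - e1) - 1 / l) / l)%:E <=
   \int[P2]_w KL (Q1 t (histo gam D2 Dt2 t w)) (Q2 t (histo gam D2 Dt2 t w)))%E.
Proof.
move=> l0.
pose H2 := histo gam D2 Dt2 t.
pose G1 hi := \int[Q1 t hi]_z phi z; pose G2 hi := \int[Q2 t hi]_z phi z.
pose N := [set z | ~ (m <= phi z <= m + c)].
have mN : measurable N.
  rewrite (_ : N = ~` (phi @^-1` `[m, m + c])); last first.
    by apply/seteqP; split => z /=; rewrite in_itv.
  by apply: measurableC; rewrite -[X in measurable X]setTI; exact: mphi.
(* The almost sure range of the regret becomes a null set of the sampling kernel at almost every
   history, as [weak_pinsker] requires. *)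
have Q2N : \forall w \ae P2, Q2 t (H2 w) N = 0%E.
  apply/(interaction_ae_kernel gam0 gam1 T0 int2 t mN).
  by apply: filterS2 Y2phi Y2m => w Yw Hw; rewrite /N/= -Yw; exact.
have G1le : \forall w \ae P2, G1 (H2 w) <= e1.
  have cE : fine (\int[P1]_w (Y1 w)%:E)%E = e1.
    by rewrite (reward_integralE int1 mphi phiK Y1phi).
  pose A := [set hi | e1 < G1 hi].
  have mA : measurable A.
    have mG : measurable_fun setT G1 by exact: measurable_kernel_average mphi phiK.
    rewrite -[X in measurable X]setTI (_ : A = G1 @^-1` `]e1, +oo[); first exact: mG.
    by apply/seteqP; split => hi /=; rewrite in_itv/= andbT.
  have mHA : measurable (H2 @^-1` A).
    rewrite -[X in measurable X]setTI.
    exact: (interaction_measurable_histo gam0 gam1 T0 int2).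
  have : P2 (H2 @^-1` A) = 0%E.
    apply: dom => //.
    apply: (cexp_const_average_le gam0 gam1 T0 int1 mphi phiK Y1phi).
    by move: condY1; rewrite cE.
  move=> /(null_set_ae mHA); apply: filterS => w /negP.
  by rewrite -leNgt.
have mG2 := measurable_average_histo gam0 gam1 T0 int2 t mphi phiK.
have iG2 := average_histo_integrable gam0 gam1 T0 int2 t mphi phiK.
(* Chosen so that the affine function [a * G2 + b] is the pointwise bound with [e1] in place of
   [G1], and integrates to the left-hand side. *)
pose a := 2 / (c * l); pose b := - a * e1 - 1 / l ^+ 2.
have ib : P2.-integrable setT (EFin \o cst b) by exact: finite_measure_integrable_cst.
have iaG2 : P2.-integrable setT (EFin \o (fun w => a * G2 (H2 w))).
  exact: (integrableZl measurableT a iG2).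
have iu : P2.-integrable setT (EFin \o (fun w => a * G2 (H2 w) + b)).
  exact: (integrableD measurableT iaG2 ib).
have -> : ((2 / c * (e2 - e1) - 1 / l) / l)%:E = (\int[P2]_w (a * G2 (H2 w) + b)%:E)%E.
  rewrite -[RHS]fineK; last exact: integrable_fin_num.
  rewrite -/(Rintegral _ _ _) RintegralD// RintegralZl//.
  rewrite -(reward_average gam0 gam1 T0 int2 t mphi phiK) -/e2.
  rewrite (_ : \int[P2]_x b = b); last first.
    by rewrite /Rintegral integral_cst// [X in (_ * X)%E]probability_setT mule1.
  by congr EFin; rewrite /b /a; field; rewrite !gt_eqF.
have KL0 w : (0 <= KL (Q1 t (H2 w)) (Q2 t (H2 w)))%E by apply: KL_ge0; exact: prob_kernel.
(* [KL] may be non-measurable in the history, but being nonnegative it has zero negative part. *)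
apply: ae_le_integral; first exact: measurable_int iu.
  apply: (eq_measurable_fun (fun=> 0%E : \bar R)) => // w _.
  by rewrite funenegE; apply/esym/max_idPr; rewrite leeNl oppe0.
apply: filterS2 Q2N G1le => w Q2N0 G1w.
apply: le_trans (_ : (((2 / c * (G2 (H2 w) - G1 (H2 w)) - 1 / l) / l)%:E <= _)%E); last first.
  apply: (weak_pinsker (N := N) (m := m) (K := K)) => //; try exact: prob_kernel.
  by move=> z /contrapT.
rewrite lee_fin (_ : a * _ + b = (2 / c * (G2 (H2 w) - e1) - 1 / l) / l); last first.
  by rewrite /b /a; field; rewrite !gt_eqF.
by rewrite ler_pM2r ?invr_gt0// lerD2r ler_pM2l ?divr_gt0// lerB.
Qed.

End round.

(** * Summation over the rounds *)

Lemma integral_sum_reward (R : realType) (T : nat) (gam : R)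
    d (Om : measurableType d) (P : probability Om R)
    (Pstar : probability (traj R T) R) (D : Om -> traj R T)
    (Dt : 'I_T -> Om -> traj R T) (Q : 'I_T -> R.-pker (hist R T) ~> traj R T)
    (Y : 'I_T -> Om -> R) (phi : traj R T -> R) (K : R) :
  interaction gam D Dt P Pstar Q ->
  measurable_fun setT phi -> (forall z, 0 <= phi z <= K) ->
  (forall t, \forall w \ae P, Y t w = phi (Dt t w)) ->
  (\int[P]_w (\sum_(t < T) Y t w)%:E = (\sum_(t < T) \int[P]_w phi (Dt t w))%:E)%E.
Proof.
move=> intP mphi phiK Yphi; have [_ mDt _ _] := intP.
have phi0 z : 0 <= phi z by have /andP[] := phiK z.
have mphiDt t : measurable_fun setT (fun w => (phi (Dt t w))%:E).
  by apply/measurable_EFinP; exact: measurableT_comp.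
transitivity (\int[P]_w \sum_(t < T) (phi (Dt t w))%:E)%E.
  apply: ae_eq_integral_nonmeasurable => //; first exact: emeasurable_sum.
  have YT : \forall w \ae P, forall t, Y t w = phi (Dt t w) by exact: filter_forall.
  by apply: filterS YT => w Yw; rewrite sumEFin; congr EFin; exact: eq_bigr.
rewrite ge0_integral_sum//; last by move=> t w _; rewrite lee_fin.
rewrite -sumEFin; apply: eq_bigr => t _.
by rewrite (@reward_integralE _ _ _ _ _ _ _ _ _ _ intP phi K t (phi \o Dt t))//; exact: nearW.
Qed.

Unset Implicit Arguments.

Theorem theorem2p3
  (R : realType) (T : nat) (B h b V B' : R) (fs : R -> R) (xs : R)
  (Pstar : probability (traj R T) R)
  (Qs Qth : 'I_T -> R.-pker (hist R T) ~> traj R T)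
  (d1 : measure_display) (Om1 : measurableType d1) (P1 : probability Om1 R)
  (D1 : Om1 -> traj R T) (Dt1 : 'I_T -> Om1 -> traj R T)
  (d2 : measure_display) (Om2 : measurableType d2) (P2 : probability Om2 R)
  (D2 : Om2 -> traj R T) (Dt2 : 'I_T -> Om2 -> traj R T) :
  (* setting *)
  0 <= B -> 0 < h -> 0 < b ->
  Pstar (box (T:=T) B) = 1%E ->
  (forall (t : 'I_T) (x : R), 0 <= x <= B ->
     (\int[Pstar]_d (nv_loss h b x (tnth d t))%:E)%E = (fs x)%:E) ->
  0 <= xs <= B -> (forall x, 0 <= x <= B -> fs xs <= fs x) ->
  (* (Om1,P1,D1,Dt1): interaction law of the ideal policy pi_star *)
  interaction (b / (b + h)) D1 Dt1 P1 Pstar Qs ->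
  (* (Om2,P2,D2,Dt2): interaction law of the deployed policy pi_theta *)
  interaction (b / (b + h)) D2 Dt2 P2 Pstar Qth ->
  (* Qs t (.|h) is the conditional law of D_{1:T} given H_{t-1} = h *)
  is_cond_law (b / (b + h)) D1 Dt1 P1 Qs ->
  is_cond_law (b / (b + h)) D2 Dt2 P2 Qs ->
  (* Qth is a probability kernel on [0,B]^T *)
  (forall (t : 'I_T) (hi : hist R T), is_hist B t hi -> Qth t hi (box (T:=T) B) = 1%E) ->
  (* (i) *)
  1 <= V ->
  (forall (t : 'I_T) (hi : hist R T), is_hist B t hi ->
     forall F : set (traj R T), measurable F ->
       (Qs t hi F = 0%E -> Qth t hi F = 0%E) /\
       ((0 < Qs t hi F)%E -> fine (Qth t hi F) / fine (Qs t hi F) <= V)) ->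
  (* (ii) E[r_t | H_{t-1}] = E[r_t] a.s. under the interaction law of pi_star *)
  (forall t : 'I_T,
     cexp_version P1 (regr (b / (b + h)) Dt1 fs xs t)
       (histo (b / (b + h)) D1 Dt1 t)
       (fun _ => fine (\int[P1]_w (regr (b / (b + h)) Dt1 fs xs t w)%:E)%E)) ->
  (* (iii) *)
  0 < B' ->
  (forall t : 'I_T, exists m : R,
     {ae P1, forall w, m <= regr (b / (b + h)) Dt1 fs xs t w <= m + B'}) ->
  (forall t : 'I_T, exists m : R,
     {ae P2, forall w, m <= regr (b / (b + h)) Dt2 fs xs t w <= m + B'}) ->
  (* conclusion (trivial when the mismatch is +oo) *)
  (Delta_comp (b / (b + h)) D2 Dt2 P2 Qs Qth < +oo)%E ->
  (BReg (b / (b + h)) Dt2 P2 fs xs <=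
   BReg (b / (b + h)) Dt1 P1 fs xs +
   (B' * Num.sqrt (T%:R * (2 + ln V) / 2
                   * fine (Delta_comp (b / (b + h)) D2 Dt2 P2 Qs Qth)))%:E)%E.
Proof.
move=> B0 h0 b0 Pbox fsE xsB xsmin int1 int2 cond1 _ Qbox V1 Vle condr B'0 _ m2 Dfin.
(* Without rounds both regrets are 0; the facts about [xhat] concern [0 < T]. *)
have [T0|T0] := posnP T.
  subst T; rewrite /BReg.
  under eq_integral do rewrite big_ord0.
  under [X in (_ <= X + _)%E]eq_integral do rewrite big_ord0.
  by rewrite !integral0 add0e lee_fin mulr_ge0 ?(ltW B'0).
set gam := b / (b + h) in int1 int2 cond1 condr m2 Dfin *.
have bh0 : 0 < b + h by exact: addr_gt0.
have gam0 : 0 < gam by exact: divr_gt0.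
have gam1 : gam <= 1 by rewrite ler_pdivrMr// mul1r lerDl ltW.
have [rho [K [mrho rhoK rhoE]]] :=
  truncated_excess_risk B0 h0 b0 (fsE (Ordinal T0)) xsB xsmin.
(* The regret as a function of the sampled completion, made measurable and bounded by truncation; on
   the box it is the true regret. *)
pose phi := rho \o @xhat R T gam.
have mphi : measurable_fun setT phi.
  by apply: measurableT_comp => //; exact: measurable_xhat.
have phiK z : 0 <= phi z <= K by exact: rhoK.
have box1 t : \forall w \ae P1, box B (Dt1 t w).
  exact: (cond_law_completion_box Pbox int1).
have box2 t : \forall w \ae P2, box B (Dt2 t w).
  exact: (completion_box gam0 gam1 T0 Pbox int2).
have Y1phi t : \forall w \ae P1, regr gam Dt1 fs xs t w = phi (Dt1 t w).
  by apply: filterS (box1 t) => w /(xhat_box gam0 gam1 T0)/rhoE.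
have Y2phi t : \forall w \ae P2, regr gam Dt2 fs xs t w = phi (Dt2 t w).
  by apply: filterS (box2 t) => w /(xhat_box gam0 gam1 T0)/rhoE.
have hist2 t : \forall w \ae P2, is_hist B t (histo gam D2 Dt2 t w).
  by apply: (histo_is_hist_ae gam0 gam1 T0 Pbox int2) => s _; exact: box2.
(* Absolute continuity in (i) is available at valid histories, which [hist2] makes almost sure under
   the deployed law. *)
have dom t := histo_dominates gam0 gam1 T0 int1 int2 hist2
  (fun t hi hB F mF => (Vle t hi hB F mF).1) (t := t).
rewrite /BReg (integral_sum_reward int1 mphi phiK Y1phi).
rewrite (integral_sum_reward int2 mphi phiK Y2phi) -EFinD lee_fin.
pose e1 t := \int[P1]_w phi (Dt1 t w); pose e2 t := \int[P2]_w phi (Dt2 t w).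
rewrite -/(\sum_t e1 t) -/(\sum_t e2 t).
set Delta := Delta_comp _ _ _ _ _ _ in Dfin *.
have Delta0 : (0 <= Delta)%E.
  apply: sume_ge0 => t _; apply: integral_ge0 => w _.
  by apply: KL_ge0; exact: prob_kernel.
have DeltaE : Delta = (fine Delta)%:E by rewrite fineK// ge0_fin_numE.
(* The same [l] serves all rounds, so the one-round bounds add up to the total mismatch; multiplying
   by [l] and then by [B' / 2] isolates the regret gap. *)
have bound l : 0 < l ->
    \sum_t e2 t - \sum_t e1 t <= B' / 2 * (l * fine Delta + T%:R / l).
  move=> l0.
  have : ((\sum_(t < T) (2 / B' * (e2 t - e1 t) - 1 / l) / l)%:E <= Delta)%E.
    rewrite -sumEFin; apply: lee_sum => t _; have [m mB'] := m2 t.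
    exact: (round_bound gam0 gam1 T0 int1 int2 mphi phiK (Y1phi t) (Y2phi t)
      (condr t) (dom t) B'0 mB' l0).
  rewrite {1}DeltaE lee_fin -mulr_suml sumrB -mulr_sumr sumrB sumr_const card_ord.
  rewrite ler_pdivrMr// -[1 / l *+ T]mulr_natl mulrA mulr1 => H.
  have := ler_wpM2l (ltW (divr_gt0 B'0 (ltr0n _ 2))) H.
  rewrite mulrBr mulrA (_ : B' / 2 * (2 / B') = 1); last by field; rewrite gt_eqF.
  rewrite mul1r mulrDr [l * _]mulrC; lra.
have T0R : 0 < T%:R :> R by rewrite ltr0n.
have := le_mul_sqrt_of_forall B'0 T0R (fine_ge0 Delta0) bound.
rewrite lerBlDl => /le_trans; apply; rewrite lerD2l ler_pM2l//.
apply: ler_wsqrtr; apply: ler_wpM2r; first exact: fine_ge0.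
(* The factor [(2 + ln V) / 2] is at least 1 because [V >= 1]. *)
rewrite -mulrA ler_peMr ?(ltW T0R)//.
by have := ln_ge0 V1; lra.
Qed.
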